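(* Let $f:\mathbb{R}^{2}\rightarrow \mathbb{R}^{2}$, $f=(f_1,f_2)$, be an entire smooth map whose graph $G_f=\{(x,y,f_1(x,y),f_2(x,y)):(x,y)\in\mathbb{R}^2\}$ is a minimal surface in $\mathbb{R}^4$, with Gaussian curvature $K$ and normal curvature $K_N$. Then $$\inf_{K<0}\frac{|K_N|}{|K|}=0,$$ (the infimum taken over the points of $G_f$ where $K<0$), unless $G_f$ is a complex analytic curve.
   Context: For a surface in $\mathbb{R}^4$ with a local orthonormal frame $\{e_1,e_2;\xi_3,\xi_4\}$, $e_1,e_2$ tangent and $\xi_3,\xi_4$ normal, set $h^{\alpha}_{ij}=\langle \overline{\nabla}_{e_i}\xi_\alpha,e_j\rangle$, where $\overline\nabla$ is the Euclidean connection. The Gauss curvature is $K=\sum_{\alpha=3}^4(h^\alpha_{11}h^\alpha_{22}-(h^\alpha_{12})^2)$ and the normal curvature is $K_N=\sum_{i=1}^2(h^3_{i1}h^4_{2i}-h^3_{2i}h^4_{1i})$ (its absolute value does not depend on the choice of frame). A complex analytic curve is the graph $\{(z,\Phi(z)):z\in\mathbb{C}\}\subset\mathbb{C}^2=\mathbb{R}^4$ of an entire holomorphic or anti-holomorphic function $\Phi:\mathbb{C}\to\mathbb{C}$; for $G_f$ this means that $f_1+if_2$, regarded as a function of $z=x+iy$, is holomorphic or anti-holomorphic.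
   Formalization: The formal theorem assumes in addition that some point of the graph has K<0; otherwise (for instance f=(x,0), a plane that is not a complex analytic curve) the infimum is over the empty set and the claim fails. *)

(* Defs.v *)
From Stdlib Require Import Reals List.
From Coquelicot Require Import Coquelicot.
Open Scope R_scope.

Definition px (g : R -> R -> R) : R -> R -> R :=
  fun x y => Derive (fun t => g t y) x.
Definition py (g : R -> R -> R) : R -> R -> R :=
  fun x y => Derive (fun t => g x t) y.

Fixpoint dpart (l : list bool) (g : R -> R -> R) : R -> R -> R :=
  match l with
  | nil => g
  | b :: l' => (if b then px else py) (dpart l' g)
  end.

Definition smooth2 (g : R -> R -> R) : Prop :=
  forall l : list bool,
    (forall x y, ex_derive (fun t => dpart l g t y) x /\
                 ex_derive (fun t => dpart l g x t) y) /\
    (forall x y, continuity_2d_pt (dpart l g) x y).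

Record V4 := mkV4 { c1 : R; c2 : R; c3 : R; c4 : R }.

Definition dot4 (u v : V4) : R :=
  c1 u * c1 v + c2 u * c2 v + c3 u * c3 v + c4 u * c4 v.

(** * The graph G_f parametrized by X(x,y) = (x, y, f1(x,y), f2(x,y)) *)

Definition Xx (f1 f2 : R -> R -> R) (x y : R) : V4 :=
  mkV4 1 0 (px f1 x y) (px f2 x y).
Definition Xy (f1 f2 : R -> R -> R) (x y : R) : V4 :=
  mkV4 0 1 (py f1 x y) (py f2 x y).

Definition X2 (f1 f2 : R -> R -> R) (a b : bool) (x y : R) : V4 :=
  mkV4 0 0 (dpart (a :: b :: nil) f1 x y) (dpart (a :: b :: nil) f2 x y).

(* w is tangent to G_f at X(x,y): since X_x=(1,0,..), X_y=(0,1,..),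
   w is tangent iff w = w_1 X_x + w_2 X_y *)
Definition tangent (f1 f2 : R -> R -> R) (x y : R) (w : V4) : Prop :=
  c3 w = c1 w * px f1 x y + c2 w * py f1 x y /\
  c4 w = c1 w * px f2 x y + c2 w * py f2 x y.

(* a local orthonormal frame {e1,e2; xi3,xi4} at the point X(x,y) of G_f:
   orthonormal in R^4, with e1, e2 tangent (hence xi3, xi4 normal) *)
Record frame := mkFrame { fe1 : V4; fe2 : V4; fxi3 : V4; fxi4 : V4 }.

Definition fvec (fr : frame) (k : nat) : V4 :=
  match k with 1 => fe1 fr | 2 => fe2 fr | 3 => fxi3 fr | _ => fxi4 fr end.

Definition adapted_frame (f1 f2 : R -> R -> R) (x y : R) (fr : frame) : Prop :=
  (forall i j : nat, (1 <= i <= 4)%nat -> (1 <= j <= 4)%nat ->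
     dot4 (fvec fr i) (fvec fr j) = if Nat.eqb i j then 1 else 0) /\
  tangent f1 f2 x y (fe1 fr) /\ tangent f1 f2 x y (fe2 fr).

(* Euclidean derivative of the position vector X along two tangent vectors
   u, v (written in the coordinates u = u_1 X_x + u_2 X_y):
   D^2 X(u,v) = sum_{a,b} u_a v_b X_ab *)
Definition coordb (w : V4) (a : bool) : R := if a then c1 w else c2 w.

Definition hessX (f1 f2 : R -> R -> R) (x y : R) (u v : V4) (w : V4) : R :=
  fold_right Rplus 0
    (map (fun ab => coordb u (fst ab) * coordb v (snd ab) *
                    dot4 w (X2 f1 f2 (fst ab) (snd ab) x y))
         ((true,true) :: (true,false) :: (false,true) :: (false,false) :: nil)).

(* h^alpha_{ij} = < Dbar_{e_i} xi_alpha , e_j > = - < xi_alpha , Dbar_{e_i} e_j >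
   = - < xi_alpha, D^2 X(e_i, e_j) >  (alpha in {3,4}, i,j in {1,2}) *)
Definition hcoef (f1 f2 : R -> R -> R) (x y : R) (fr : frame)
  (alpha i j : nat) : R :=
  - hessX f1 f2 x y (fvec fr i) (fvec fr j) (fvec fr alpha).
Arguments hcoef f1 f2 x y fr (alpha i j)%_nat_scope.

Definition gaussK (f1 f2 : R -> R -> R) (x y : R) (fr : frame) : R :=
  (hcoef f1 f2 x y fr 3 1 1 * hcoef f1 f2 x y fr 3 2 2 - (hcoef f1 f2 x y fr 3 1 2) ^ 2)
  + (hcoef f1 f2 x y fr 4 1 1 * hcoef f1 f2 x y fr 4 2 2 - (hcoef f1 f2 x y fr 4 1 2) ^ 2).

Definition normalK (f1 f2 : R -> R -> R) (x y : R) (fr : frame) : R :=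
  (hcoef f1 f2 x y fr 3 1 1 * hcoef f1 f2 x y fr 4 2 1
     - hcoef f1 f2 x y fr 3 2 1 * hcoef f1 f2 x y fr 4 1 1)
  + (hcoef f1 f2 x y fr 3 2 1 * hcoef f1 f2 x y fr 4 2 2
     - hcoef f1 f2 x y fr 3 2 2 * hcoef f1 f2 x y fr 4 1 2).

Definition minimal_graph (f1 f2 : R -> R -> R) : Prop :=
  forall x y fr, adapted_frame f1 f2 x y fr ->
    (hcoef f1 f2 x y fr 3 1 1 + hcoef f1 f2 x y fr 3 2 2 = 0) /\
    (hcoef f1 f2 x y fr 4 1 1 + hcoef f1 f2 x y fr 4 2 2 = 0).

Definition entire_holomorphic (Phi : C -> C) : Prop :=
  forall z : C, ex_derive (K := C_AbsRing) (V := C_NormedModule) Phi z.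

Definition entire_antiholomorphic (Phi : C -> C) : Prop :=
  entire_holomorphic (fun w => Phi (Cconj w)).

Definition cplx_of (f1 f2 : R -> R -> R) : C -> C :=
  fun z => (f1 (Re z) (Im z), f2 (Re z) (Im z)).

Definition complex_analytic_graph (f1 f2 : R -> R -> R) : Prop :=
  entire_holomorphic (cplx_of f1 f2) \/ entire_antiholomorphic (cplx_of f1 f2).

Definition ratio_set (f1 f2 : R -> R -> R) : R -> Prop :=
  fun r => exists x y fr, adapted_frame f1 f2 x y fr /\
    gaussK f1 f2 x y fr < 0 /\
    r = Rabs (normalK f1 f2 x y fr) / Rabs (gaussK f1 f2 x y fr).

(* Main.v *)
(** Let [E, F, G] be the coefficients of the metric of the graph and
    [W = sqrt (E G - F^2)].  The minimal surface equation says that [(E/W, F/W)]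
    and [(F/W, G/W)] are closed forms, i.e. these functions are the second
    derivatives of a convex [phi] with [det D^2 phi = 1].  By Jörgens' theorem
    (in Nitsche's proof: Lewy's map [x + grad phi] is an expanding bijection onto
    the plane, in whose coordinates the conjugate of [x - grad phi] is entire and
    nonexpansive, hence affine) they are constants [a, b, c].  So the linear
    coordinates [x = u - b v, y = a v] are isothermal and [f = f1 + i f2] is
    harmonic in [z = u + i v]; put [P = 2 d_z f] and [Q = conj (2 d_zbar f)],
    which are entire.  Conformality makes [P Q] a constant.  If it is [0], then
    [P] or [Q] vanishes identically and the graph is complex analytic.  Otherwise
    [|K_N| / |K| <= (a + c) | |P'|^2 - |Q'|^2 | / (|P'|^2 + |Q'|^2)], where
    [|P'| / |P| = |Q'| / |Q|], so the ratio is small where [|P|] is close to [|Q|]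
    and [P' <> 0].  Such points exist: by Liouville's theorem applied to [P] and
    [Q], [|P|] takes values on both sides of [sqrt |P Q|], and along a segment
    between two such points [P'] cannot vanish throughout the crossing. *)
From Stdlib Require Import Reals Lra Lia Psatz Classical List.
From Coquelicot Require Import Coquelicot.
Require Import Defs.
Open Scope R_scope.

(** * Differentiability and the mean value property *)

(** The analytic tool is the mean value property on circles; no Cauchy formula, power series or
    mapping degree enters. It is set up for functions given off the centre with a limit there, so
    that it applies to the difference quotient of a bounded entire function and yields Liouville's
    theorem. Unique continuation serves only to pass from [P Q = 0] to the vanishing of one factor.

    Closeness of [|P|] to [|Q|] alone does not produce a small ratio: the curvature vanishes where
    [P' = Q' = 0], and such points do not count. A point must be found where the moduli are close
    and [P'] is nonzero at the same time.

    The factor [a + c] comes from the normals [(-∇f1, 1, 0)] and [(-∇f2, 0, 1)] not being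
    orthonormal: it is the trace [E + G] of their Gram matrix, divided by [W]. That it is constant
    is a second use of Jörgens' theorem; otherwise it could grow along the points where the other
    factor becomes small. *)

Lemma is_derive_eq (f : R -> R) (x l l' : R) :
  is_derive f x l -> l = l' -> is_derive f x l'.
Proof. now intros H <-. Qed.

Lemma dpl_eq (f : R -> R -> R) (x y a b a' b' : R) :
  differentiable_pt_lim f x y a b -> a = a' -> b = b' ->
  differentiable_pt_lim f x y a' b'.
Proof. now intros H <- <-. Qed.

Lemma dpl_ext (f g : R -> R -> R) (x y a b : R) :
  (forall u v, f u v = g u v) ->
  differentiable_pt_lim f x y a b -> differentiable_pt_lim g x y a b.
Proof.
  intros H; apply differentiable_pt_lim_ext.
  exists (mkposreal 1 Rlt_0_1); auto.
Qed.

Lemma dpl_C1 (f fx fy : R -> R -> R) :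
  (forall x y, is_derive (fun t => f t y) x (fx x y)) ->
  (forall x y, is_derive (fun t => f x t) y (fy x y)) ->
  (forall x y, continuity_2d_pt fx x y) ->
  forall x y, differentiable_pt_lim f x y (fx x y) (fy x y).
Proof.
  intros Hx Hy Hc x y.
  apply filterdiff_differentiable_pt_lim.
  apply (is_derive_filterdiff f x y fx (fy x y)).
  - apply filter_forall; intros [u v]; apply Hx.
  - apply Hy.
  - apply continuity_2d_pt_filterlim, Hc.
Qed.

Lemma dpl_plus (f g : R -> R -> R) (x y fx fy gx gy : R) :
  differentiable_pt_lim f x y fx fy -> differentiable_pt_lim g x y gx gy ->
  differentiable_pt_lim (fun u v => f u v + g u v) x y (fx + gx) (fy + gy).
Proof.
  intros Hf Hg.
  eapply dpl_eq.
  - apply (differentiable_pt_lim_comp Rplus f g x y 1 1 fx fy gx gy); trivial.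
    apply (dpl_C1 Rplus (fun _ _ => 1) (fun _ _ => 1)).
    + intros a b; auto_derive; trivial.
    + intros a b; auto_derive; trivial.
    + intros; apply continuity_2d_pt_const.
  - ring.
  - ring.
Qed.

Lemma dpl_mult (f g : R -> R -> R) (x y fx fy gx gy : R) :
  differentiable_pt_lim f x y fx fy -> differentiable_pt_lim g x y gx gy ->
  differentiable_pt_lim (fun u v => f u v * g u v) x y
    (fx * g x y + f x y * gx) (fy * g x y + f x y * gy).
Proof.
  intros Hf Hg.
  eapply dpl_eq.
  - apply (differentiable_pt_lim_comp Rmult f g x y (g x y) (f x y)
             fx fy gx gy); trivial.
    apply (dpl_C1 Rmult (fun _ b => b) (fun a _ => a)).
    + intros a b; auto_derive; trivial; ring.
    + intros a b; auto_derive; trivial; ring.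
    + intros; apply continuity_2d_pt_id2.
  - ring.
  - ring.
Qed.

Lemma dpl_1d (phi : R -> R) (f : R -> R -> R) (x y l fx fy : R) :
  is_derive phi (f x y) l -> differentiable_pt_lim f x y fx fy ->
  differentiable_pt_lim (fun u v => phi (f u v)) x y (l * fx) (l * fy).
Proof.
  intros Hp Hf.
  eapply dpl_eq.
  - apply (differentiable_pt_lim_comp (fun a _ => phi a) f f x y l 0
             fx fy fx fy); trivial.
    apply differentiable_pt_lim_proj1_0. now apply is_derive_Reals.
  - ring.
  - ring.
Qed.

Lemma dpl_const (c x y : R) : differentiable_pt_lim (fun _ _ => c) x y 0 0.
Proof.
  apply (dpl_C1 (fun _ _ => c) (fun _ _ => 0) (fun _ _ => 0)).
  - intros; auto_derive; trivial.
  - intros; auto_derive; trivial.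
  - intros; apply continuity_2d_pt_const.
Qed.

Lemma dpl_fst (x y : R) : differentiable_pt_lim (fun u _ => u) x y 1 0.
Proof.
  apply (dpl_C1 (fun u _ => u) (fun _ _ => 1) (fun _ _ => 0)).
  - intros; auto_derive; trivial.
  - intros; auto_derive; trivial.
  - intros; apply continuity_2d_pt_const.
Qed.

Lemma dpl_snd (x y : R) : differentiable_pt_lim (fun _ v => v) x y 0 1.
Proof.
  apply (dpl_C1 (fun _ v => v) (fun _ _ => 0) (fun _ _ => 1)).
  - intros; auto_derive; trivial.
  - intros; auto_derive; trivial.
  - intros; apply continuity_2d_pt_const.
Qed.

Lemma dpl_opp (f : R -> R -> R) (x y fx fy : R) :
  differentiable_pt_lim f x y fx fy ->
  differentiable_pt_lim (fun u v => - f u v) x y (- fx) (- fy).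
Proof.
  intros Hf. eapply dpl_eq.
  - apply (dpl_1d Ropp f x y (-1) fx fy); trivial. auto_derive; trivial; ring.
  - ring.
  - ring.
Qed.

Lemma dpl_minus (f g : R -> R -> R) (x y fx fy gx gy : R) :
  differentiable_pt_lim f x y fx fy -> differentiable_pt_lim g x y gx gy ->
  differentiable_pt_lim (fun u v => f u v - g u v) x y (fx - gx) (fy - gy).
Proof. intros Hf Hg. now apply dpl_plus; [|apply dpl_opp]. Qed.

Lemma dpl_scal (c : R) (f : R -> R -> R) (x y fx fy : R) :
  differentiable_pt_lim f x y fx fy ->
  differentiable_pt_lim (fun u v => c * f u v) x y (c * fx) (c * fy).
Proof.
  intros Hf.
  eapply dpl_eq; [apply (dpl_mult (fun _ _ => c)); [apply dpl_const|apply Hf]| |];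
  ring.
Qed.

Lemma dpl_cont (f : R -> R -> R) (x y a b : R) :
  differentiable_pt_lim f x y a b -> continuity_2d_pt f x y.
Proof.
  intros H; apply differentiable_continuity_pt. now exists a, b.
Qed.

Lemma dpl_is_derive (f : R -> R -> R) (x y a b : R) :
  differentiable_pt_lim f x y a b ->
  is_derive (fun t => f t y) x a /\ is_derive (fun t => f x t) y b.
Proof.
  intros H; split; apply is_derive_Reals.
  - replace a with (a * 1 + b * 0) by ring.
    apply (derivable_pt_lim_comp_2d f (fun t => t) (fun _ => y)); trivial.
    apply derivable_pt_lim_id. apply derivable_pt_lim_const.
  - replace b with (a * 0 + b * 1) by ring.
    apply (derivable_pt_lim_comp_2d f (fun _ => x) (fun t => t)); trivial.
    apply derivable_pt_lim_const. apply derivable_pt_lim_id.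
Qed.

Lemma dpl_curve (f : R -> R -> R) (g h : R -> R) (t a b g' h' : R) :
  differentiable_pt_lim f (g t) (h t) a b ->
  is_derive g t g' -> is_derive h t h' ->
  is_derive (fun s => f (g s) (h s)) t (a * g' + b * h').
Proof.
  intros H Hg Hh; apply is_derive_Reals.
  apply derivable_pt_lim_comp_2d; trivial; now apply is_derive_Reals.
Qed.

Lemma cont2_comp (f g h : R -> R -> R) (x y : R) :
  continuity_2d_pt f (g x y) (h x y) ->
  continuity_2d_pt g x y -> continuity_2d_pt h x y ->
  continuity_2d_pt (fun u v => f (g u v) (h u v)) x y.
Proof.
  intros Hf Hg Hh eps.
  destruct (Hf eps) as [d Hd].
  destruct (Hg d) as [d1 H1], (Hh d) as [d2 H2].
  assert (Hm : 0 < Rmin d1 d2) by (apply Rmin_pos; apply cond_pos).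
  exists (mkposreal _ Hm); simpl; intros u v Hu Hv.
  apply Hd.
  - apply H1; eapply Rlt_le_trans; eauto using Rmin_l.
  - apply H2; eapply Rlt_le_trans; eauto using Rmin_r.
Qed.

Lemma cont2_curve (f : R -> R -> R) (g h : R -> R) (t : R) :
  continuity_2d_pt f (g t) (h t) ->
  continuous g t -> continuous h t -> continuous (fun s => f (g s) (h s)) t.
Proof.
  intros Hf Hg Hh.
  apply (continuous_comp_2 g h f t Hg Hh).
  now apply continuity_2d_pt_filterlim.
Qed.

Ltac cont2 := repeat first
  [ assumption
  | apply continuity_2d_pt_plus | apply continuity_2d_pt_minus
  | apply continuity_2d_pt_mult | apply continuity_2d_pt_opp
  | apply continuity_2d_pt_id1 | apply continuity_2d_pt_id2
  | apply continuity_2d_pt_const ].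

(* [cderiv U V A B x y] says that [U + iV] is complex differentiable at
   [x + iy] with derivative [A + iB]. *)
Definition cderiv (U V A B : R -> R -> R) (x y : R) : Prop :=
  differentiable_pt_lim U x y (A x y) (- B x y) /\
  differentiable_pt_lim V x y (B x y) (A x y).

(** In polar coordinates the Cauchy-Riemann equations read [U_r = V_t / r]. The [r]-derivative of
    the circle integral is thus the integral of a derivative of a periodic function, hence 0. The
    integral does not depend on [r], and its limit as [r] tends to 0 is [2 * PI * L]. *)
Lemma circle_mean (U V A B : R -> R -> R) (x0 y0 L : R) :
  (forall x y, x <> x0 \/ y <> y0 -> cderiv U V A B x y) ->
  (forall x y, x <> x0 \/ y <> y0 ->
     continuity_2d_pt A x y /\ continuity_2d_pt B x y) ->
  (forall eps, 0 < eps -> exists d, 0 < d /\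
     forall x y, x <> x0 \/ y <> y0 -> Rabs (x - x0) < d -> Rabs (y - y0) < d ->
     Rabs (U x y - L) < eps) ->
  forall r, 0 < r ->
  is_RInt (fun t => U (x0 + r * cos t) (y0 + r * sin t)) 0 (2 * PI) (2 * PI * L).
Proof.
  intros HD HC HL.
  assert (off : forall r t, 0 < r ->
    x0 + r * cos t <> x0 \/ y0 + r * sin t <> y0).
  { intros r t Hr.
    destruct (Req_dec (x0 + r * cos t) x0) as [E1|]; [|now left].
    destruct (Req_dec (y0 + r * sin t) y0) as [E2|]; [|now right].
    exfalso. generalize (sin2_cos2 t); unfold Rsqr.
    assert (r * cos t = 0) by lra. assert (r * sin t = 0) by lra.
    assert (cos t = 0) by nra. assert (sin t = 0) by nra. nra. }
  set (f := fun r t => U (x0 + r * cos t) (y0 + r * sin t)).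
  set (dr := fun r t => A (x0 + r * cos t) (y0 + r * sin t) * cos t
                        - B (x0 + r * cos t) (y0 + r * sin t) * sin t).
  assert (Hr : forall r t, 0 < r -> is_derive (fun z => f z t) r (dr r t)).
  { intros r t Hrp. unfold f, dr.
    destruct (HD _ _ (off r t Hrp)) as [HU _].
    eapply is_derive_eq.
    - apply (dpl_curve U (fun z => x0 + z * cos t) (fun z => y0 + z * sin t) r
        _ _ (cos t) (sin t) HU); auto_derive; trivial; ring.
    - ring. }
  assert (Ht : forall r t, 0 < r ->
    is_derive (fun s => / r * V (x0 + r * cos s) (y0 + r * sin s)) t (dr r t)).
  { intros r t Hrp. unfold dr.
    destruct (HD _ _ (off r t Hrp)) as [_ HV].
    eapply is_derive_eq.
    - apply (is_derive_scal (fun s => V (x0 + r * cos s) (y0 + r * sin s))).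
      apply (dpl_curve V (fun s => x0 + r * cos s) (fun s => y0 + r * sin s) t
        _ _ (- r * sin t) (r * cos t) HV); auto_derive; trivial; ring.
    - unfold scal; simpl; unfold mult; simpl. field. lra. }
  assert (Hpos : forall r t, 0 < r ->
     continuity_2d_pt (fun a b => x0 + a * cos b) r t /\
     continuity_2d_pt (fun a b => y0 + a * sin b) r t /\
     continuity_2d_pt (fun a b => cos b) r t /\
     continuity_2d_pt (fun a b => sin b) r t).
  { intros r t _.
    assert (Hcs : continuity_2d_pt (fun a b => cos b) r t).
    { apply (continuity_1d_2d_pt_comp cos (fun _ b => b));
        [apply continuity_cos | cont2]. }
    assert (Hsn : continuity_2d_pt (fun a b => sin b) r t).
    { apply (continuity_1d_2d_pt_comp sin (fun _ b => b));
        [apply continuity_sin | cont2]. }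
    repeat split; cont2. }
  assert (Hdr : forall r t, 0 < r -> continuity_2d_pt dr r t).
  { intros r t Hrp. destruct (Hpos r t Hrp) as (H1 & H2 & H3 & H4).
    destruct (HC _ _ (off r t Hrp)) as [HA HB].
    unfold dr. apply continuity_2d_pt_minus; apply continuity_2d_pt_mult;
      try assumption; now apply cont2_comp. }
  assert (Hcf : forall r t, 0 < r -> continuous (fun s => f r s) t).
  { intros r t Hrp. unfold f.
    apply (cont2_curve U (fun s => x0 + r * cos s) (fun s => y0 + r * sin s)).
    - destruct (HD _ _ (off r t Hrp)) as [HU _]. exact (dpl_cont _ _ _ _ _ HU).
    - apply (ex_derive_continuous (fun s => x0 + r * cos s)); auto_derive; trivial.
    - apply (ex_derive_continuous (fun s => y0 + r * sin s)); auto_derive; trivial. }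
  assert (Hex : forall r, 0 < r -> ex_RInt (fun t => f r t) 0 (2 * PI)).
  { intros r Hrp. apply (ex_RInt_continuous (fun t => f r t)).
    intros z _. now apply Hcf. }
  set (M := fun r => RInt (fun t => f r t) 0 (2 * PI)).
  assert (nearby : forall r, 0 < r -> forall u, Rabs (u - r) < r -> 0 < u).
  { intros r Hrp u Hu. apply Rabs_def2 in Hu. lra. }
  assert (HM : forall r, 0 < r -> is_derive M r 0).
  { intros r Hrp.
    assert (E : RInt (fun t => Derive (fun u => f u t) r) 0 (2 * PI) = 0).
    { rewrite (RInt_ext _ (dr r)).
      2:{ intros t _. now apply is_derive_unique, Hr. }
      apply is_RInt_unique.
      replace 0 with (minus (/ r * V (x0 + r * cos (2 * PI)) (y0 + r * sin (2 * PI)))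
                            (/ r * V (x0 + r * cos 0) (y0 + r * sin 0))) at 2.
      2:{ rewrite cos_2PI, sin_2PI, cos_0, sin_0. unfold minus, plus, opp; simpl. ring. }
      apply (is_RInt_derive (fun s => / r * V (x0 + r * cos s) (y0 + r * sin s))).
      - intros t _. now apply Ht.
      - intros t _. apply (cont2_curve dr (fun _ => r) (fun s => s)).
        + now apply Hdr.
        + apply continuous_const.
        + apply continuous_id. }
    rewrite <- E.
    apply (is_derive_RInt_param f 0 (2 * PI) r).
    - exists (mkposreal r Hrp). intros u Hu t _.
      exists (dr u t). apply Hr. now apply (nearby r Hrp).
    - intros t _. apply (continuity_2d_pt_ext_loc dr).
      2: now apply Hdr.
      exists (mkposreal r Hrp). intros u v Hu _. symmetry.
      apply is_derive_unique, Hr. now apply (nearby r Hrp).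
    - exists (mkposreal r Hrp). intros u Hu. apply Hex.
      now apply (nearby r Hrp). }
  assert (Mconst : forall r s, 0 < r -> 0 < s -> M r = M s).
  { intros r s Hrp Hsp.
    assert (Hmin : 0 < Rmin r s) by now apply Rmin_pos.
    destruct (MVT_gen M r s (fun _ => 0)) as [c [_ Hc]].
    - intros x Hx. apply HM. lra.
    - intros x Hx. apply continuity_pt_filterlim.
      apply (ex_derive_continuous M). exists 0. apply HM. lra.
    - lra. }
  assert (P0 := PI_RGT_0).
  assert (ML : forall r, 0 < r -> M r = 2 * PI * L).
  { intros r Hrp.
    destruct (Req_dec (M r) (2 * PI * L)) as [|N]; trivial. exfalso.
    set (e := Rabs (M r - 2 * PI * L)).
    assert (He : 0 < e) by (apply Rabs_pos_lt; lra).
    (* Integrated over an interval of length [2 * PI], this tolerance gives [e / 2], half of the gap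
       to be refuted. *)
    destruct (HL (e / (4 * PI))) as [d [Hd Hd']].
    { apply Rdiv_lt_0_compat; lra. }
    set (s := d / 2).
    assert (Hs : 0 < s) by (unfold s; lra).
    assert (HI : forall r, 0 < r ->
      is_RInt (fun t => f r t - L) 0 (2 * PI) (M r - 2 * PI * L)).
    { intros q Hq. replace (2 * PI * L) with ((2 * PI - 0) * L) by ring.
      apply (is_RInt_minus (V := R_NormedModule)).
      - apply (RInt_correct (fun t => f q t)). now apply Hex.
      - apply (is_RInt_const (V := R_NormedModule)). }
    assert (HB : Rabs (RInt (fun t => f s t - L) 0 (2 * PI))
                 <= (2 * PI - 0) * (e / (4 * PI))).
    { apply abs_RInt_le_const; [lra| |].
      - eexists; now apply HI.
      - intros t _. left. unfold f. apply Hd'; [now apply off| |].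
        + replace (x0 + s * cos t - x0) with (s * cos t) by ring.
          rewrite Rabs_mult, (Rabs_pos_eq s) by lra.
          assert (Rabs (cos t) <= 1) by (apply Rabs_le; apply COS_bound).
          assert (0 <= Rabs (cos t)) by apply Rabs_pos. unfold s in *; nra.
        + replace (y0 + s * sin t - y0) with (s * sin t) by ring.
          rewrite Rabs_mult, (Rabs_pos_eq s) by lra.
          assert (Rabs (sin t) <= 1) by (apply Rabs_le; apply SIN_bound).
          assert (0 <= Rabs (sin t)) by apply Rabs_pos. unfold s in *; nra. }
    rewrite (is_RInt_unique _ _ _ _ (HI s Hs)), (Mconst s r Hs Hrp) in HB.
    fold e in HB.
    replace ((2 * PI - 0) * (e / (4 * PI))) with (e / 2) in HB by (field; lra).
    lra. }
  intros r Hrp. rewrite <- (ML r Hrp).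
  apply (RInt_correct (fun t => f r t)). now apply Hex.
Qed.

Lemma circle_bound (U V A B : R -> R -> R) (x0 y0 L : R) :
  (forall x y, x <> x0 \/ y <> y0 -> cderiv U V A B x y) ->
  (forall x y, x <> x0 \/ y <> y0 ->
     continuity_2d_pt A x y /\ continuity_2d_pt B x y) ->
  (forall eps, 0 < eps -> exists d, 0 < d /\
     forall x y, x <> x0 \/ y <> y0 -> Rabs (x - x0) < d -> Rabs (y - y0) < d ->
     Rabs (U x y - L) < eps) ->
  forall r M, 0 < r ->
  (forall t, 0 <= t <= 2 * PI -> Rabs (U (x0 + r * cos t) (y0 + r * sin t)) <= M) ->
  Rabs L <= M.
Proof.
  intros HD HC HL r M Hr HM.
  pose proof (circle_mean U V A B x0 y0 L HD HC HL r Hr) as HI.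
  assert (P0 := PI_RGT_0).
  assert (H : Rabs (2 * PI * L) <= (2 * PI - 0) * M).
  { rewrite <- (is_RInt_unique _ _ _ _ HI).
    apply abs_RInt_le_const; [lra| |intros; now apply HM].
    now exists (2 * PI * L). }
  rewrite Rabs_mult, (Rabs_pos_eq (2 * PI)) in H by lra.
  apply Rmult_le_reg_l with (2 * PI); lra.
Qed.

(** * Liouville's theorem and unique continuation *)

Lemma cderiv_mult (U1 V1 A1 B1 U2 V2 A2 B2 : R -> R -> R) (x y : R) :
  cderiv U1 V1 A1 B1 x y -> cderiv U2 V2 A2 B2 x y ->
  cderiv (fun u v => U1 u v * U2 u v - V1 u v * V2 u v)
         (fun u v => U1 u v * V2 u v + V1 u v * U2 u v)
         (fun u v => A1 u v * U2 u v - B1 u v * V2 u v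
                     + (U1 u v * A2 u v - V1 u v * B2 u v))
         (fun u v => A1 u v * V2 u v + B1 u v * U2 u v
                     + (U1 u v * B2 u v + V1 u v * A2 u v)) x y.
Proof.
  intros [HU1 HV1] [HU2 HV2]; split.
  - eapply dpl_eq.
    + apply dpl_minus; apply dpl_mult; eassumption.
    + ring.
    + ring.
  - eapply dpl_eq.
    + apply dpl_plus; apply dpl_mult; eassumption.
    + ring.
    + ring.
Qed.

Lemma cderiv_minus (U1 V1 A1 B1 U2 V2 A2 B2 : R -> R -> R) (x y : R) :
  cderiv U1 V1 A1 B1 x y -> cderiv U2 V2 A2 B2 x y ->
  cderiv (fun u v => U1 u v - U2 u v) (fun u v => V1 u v - V2 u v)
         (fun u v => A1 u v - A2 u v) (fun u v => B1 u v - B2 u v) x y.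
Proof.
  intros [HU1 HV1] [HU2 HV2]; split.
  - eapply dpl_eq; [apply dpl_minus; eassumption|ring|ring].
  - eapply dpl_eq; [apply dpl_minus; eassumption|ring|ring].
Qed.

(* Multiplication by [-i]. *)
Lemma cderiv_rot (U V A B : R -> R -> R) (x y : R) :
  cderiv U V A B x y ->
  cderiv V (fun u v => - U u v) B (fun u v => - A u v) x y.
Proof.
  intros [HU HV]; split.
  - eapply dpl_eq; [exact HV|ring|ring].
  - eapply dpl_eq; [apply dpl_opp; exact HU|ring|ring].
Qed.

(** * Division by a linear factor *)

Definition sqdist (x1 y1 x y : R) : R := (x - x1) ^ 2 + (y - y1) ^ 2.
(** Real part, and next imaginary part, of [1 / (z - z1)], whose derivative is minus its square. *)
Definition inv_re (x1 y1 x y : R) : R := (x - x1) * / sqdist x1 y1 x y.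
Definition inv_im (x1 y1 x y : R) : R := - (y - y1) * / sqdist x1 y1 x y.

Lemma sqdist_pos (x1 y1 x y : R) :
  x <> x1 \/ y <> y1 -> 0 < sqdist x1 y1 x y.
Proof.
  unfold sqdist; intros [H|H].
  - assert (0 < (x - x1) ^ 2) by (apply pow2_gt_0; lra).
    pose proof (pow2_ge_0 (y - y1)); lra.
  - assert (0 < (y - y1) ^ 2) by (apply pow2_gt_0; lra).
    pose proof (pow2_ge_0 (x - x1)); lra.
Qed.

Lemma dpl_sqdist (x1 y1 x y : R) :
  differentiable_pt_lim (sqdist x1 y1) x y (2 * (x - x1)) (2 * (y - y1)).
Proof.
  eapply dpl_eq.
  - apply (dpl_plus (fun u _ => (u - x1) ^ 2) (fun _ v => (v - y1) ^ 2)).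
    + apply (dpl_1d (fun a => (a - x1) ^ 2) (fun u _ => u) x y (2 * (x - x1))).
      * auto_derive; trivial; ring.
      * apply dpl_fst.
    + apply (dpl_1d (fun a => (a - y1) ^ 2) (fun _ v => v) x y (2 * (y - y1))).
      * auto_derive; trivial; ring.
      * apply dpl_snd.
  - ring.
  - ring.
Qed.

Lemma cderiv_inv (x1 y1 x y : R) :
  x <> x1 \/ y <> y1 ->
  cderiv (inv_re x1 y1) (inv_im x1 y1)
    (fun u v => (inv_im x1 y1 u v) ^ 2 - (inv_re x1 y1 u v) ^ 2)
    (fun u v => - 2 * inv_re x1 y1 u v * inv_im x1 y1 u v) x y.
Proof.
  intros H; pose proof (sqdist_pos _ _ _ _ H) as Hp.
  assert (Hi : differentiable_pt_lim (fun u v => / sqdist x1 y1 u v) x y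
     (- / (sqdist x1 y1 x y) ^ 2 * (2 * (x - x1)))
     (- / (sqdist x1 y1 x y) ^ 2 * (2 * (y - y1)))).
  { apply (dpl_1d Rinv (sqdist x1 y1)); [|apply dpl_sqdist].
    auto_derive; [lra|field; lra]. }
  split; unfold inv_re, inv_im.
  - eapply dpl_eq.
    + apply (dpl_mult (fun u v => u - x1) (fun u v => / sqdist x1 y1 u v)).
      * apply (dpl_minus (fun u _ => u) (fun _ _ => x1));
          [apply dpl_fst|apply dpl_const].
      * exact Hi.
    + unfold sqdist in *; field; lra.
    + unfold sqdist in *; field; lra.
  - eapply dpl_eq.
    + apply (dpl_mult (fun u v => - (v - y1)) (fun u v => / sqdist x1 y1 u v)).
      * apply dpl_opp, (dpl_minus (fun _ v => v) (fun _ _ => y1));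
          [apply dpl_snd|apply dpl_const].
      * exact Hi.
    + unfold sqdist in *; field; lra.
    + unfold sqdist in *; field; lra.
Qed.

(** Continuity of the derivative belongs to the notion because circle means are differentiated under
    the integral sign. *)
Definition entire (U V A B : R -> R -> R) : Prop :=
  forall x y, cderiv U V A B x y /\ continuity_2d_pt A x y /\ continuity_2d_pt B x y.

Lemma entire_rot (U V A B : R -> R -> R) :
  entire U V A B -> entire V (fun u v => - U u v) B (fun u v => - A u v).
Proof.
  intros H x y; destruct (H x y) as (H1 & H2 & H3).
  split; [now apply cderiv_rot|split; cont2].
Qed.

Lemma entire_cont (U V A B : R -> R -> R) :
  entire U V A B -> forall x y, continuity_2d_pt U x y /\ continuity_2d_pt V x y.
Proof.
  intros H x y; destruct (H x y) as ([HU HV] & _).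
  split; eapply dpl_cont; eassumption.
Qed.

Definition div_re (x1 y1 : R) (U V : R -> R -> R) (x y : R) : R :=
  U x y * inv_re x1 y1 x y - V x y * inv_im x1 y1 x y.
Definition div_im (x1 y1 : R) (U V : R -> R -> R) (x y : R) : R :=
  U x y * inv_im x1 y1 x y + V x y * inv_re x1 y1 x y.
Definition ddiv_re (x1 y1 : R) (U V A B : R -> R -> R) (x y : R) : R :=
  A x y * inv_re x1 y1 x y - B x y * inv_im x1 y1 x y
  + (U x y * (inv_im x1 y1 x y ^ 2 - inv_re x1 y1 x y ^ 2)
     - V x y * (- 2 * inv_re x1 y1 x y * inv_im x1 y1 x y)).
Definition ddiv_im (x1 y1 : R) (U V A B : R -> R -> R) (x y : R) : R :=
  A x y * inv_im x1 y1 x y + B x y * inv_re x1 y1 x y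
  + (U x y * (- 2 * inv_re x1 y1 x y * inv_im x1 y1 x y)
     + V x y * (inv_im x1 y1 x y ^ 2 - inv_re x1 y1 x y ^ 2)).

Lemma cderiv_div (x1 y1 : R) (U V A B : R -> R -> R) :
  entire U V A B -> forall x y, x <> x1 \/ y <> y1 ->
  cderiv (div_re x1 y1 U V) (div_im x1 y1 U V)
         (ddiv_re x1 y1 U V A B) (ddiv_im x1 y1 U V A B) x y /\
  continuity_2d_pt (ddiv_re x1 y1 U V A B) x y /\
  continuity_2d_pt (ddiv_im x1 y1 U V A B) x y.
Proof.
  intros H x y Hne.
  destruct (H x y) as (HD & HA & HB).
  destruct (entire_cont _ _ _ _ H x y) as [HU HV].
  pose proof (cderiv_inv x1 y1 x y Hne) as Hi.
  assert (Hre : continuity_2d_pt (inv_re x1 y1) x y).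
  { destruct Hi as [Hi _]; exact (dpl_cont _ _ _ _ _ Hi). }
  assert (Him : continuity_2d_pt (inv_im x1 y1) x y).
  { destruct Hi as [_ Hi]; exact (dpl_cont _ _ _ _ _ Hi). }
  split; [exact (cderiv_mult _ _ _ _ _ _ _ _ x y HD Hi)|].
  unfold ddiv_re, ddiv_im; simpl; split; cont2.
Qed.

Lemma div_sqmod (x1 y1 : R) (U V : R -> R -> R) (x y : R) :
  x <> x1 \/ y <> y1 ->
  ((div_re x1 y1 U V x y) ^ 2 + (div_im x1 y1 U V x y) ^ 2) * sqdist x1 y1 x y
  = (U x y) ^ 2 + (V x y) ^ 2.
Proof.
  intros H; pose proof (sqdist_pos _ _ _ _ H) as Hp.
  unfold div_re, div_im, inv_re, inv_im, sqdist in *. field. lra.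
Qed.

Lemma Rabs_le_of_sq (a m : R) : 0 <= m -> a ^ 2 <= m ^ 2 -> Rabs a <= m.
Proof. intros Hm H; apply Rabs_le; nra. Qed.

Lemma circle_sqdist (x0 y0 r t : R) :
  sqdist x0 y0 (x0 + r * cos t) (y0 + r * sin t) = r ^ 2.
Proof.
  unfold sqdist. generalize (sin2_cos2 t); unfold Rsqr; intros.
  replace (r ^ 2) with (r ^ 2 * (sin t * sin t + cos t * cos t)) by (rewrite H; ring).
  ring.
Qed.

(** The difference quotient of [U + iV] at [(x0, y0)] has a limit there with real part [A x0 y0]. On
    the circle of radius [r] its real part is [(u cos t + v sin t) / r] with [u], [v] bounded by
    [2 * M]. The mean value property bounds the limit by [4 * M / r], and [r] is arbitrary. *)
Lemma liouville_re (U V A B : R -> R -> R) (M : R) :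
  entire U V A B -> (forall x y, Rabs (U x y) <= M /\ Rabs (V x y) <= M) ->
  forall x y, A x y = 0.
Proof.
  intros H HM x0 y0.
  set (U0 := fun u v => U u v - U x0 y0).
  set (V0 := fun u v => V u v - V x0 y0).
  assert (H0 : entire U0 V0 (fun u v => A u v - 0) (fun u v => B u v - 0)).
  { intros x y; destruct (H x y) as (H1 & H2 & H3); repeat split.
    - eapply dpl_eq; [apply dpl_minus; [apply H1|apply dpl_const]|ring|ring].
    - eapply dpl_eq; [apply dpl_minus; [apply H1|apply dpl_const]|ring|ring].
    - cont2.
    - cont2. }
  assert (Mpos : 0 <= M).
  { destruct (HM 0 0) as [h _]. pose proof (Rabs_pos (U 0 0)); lra. }
  assert (key : forall r, 0 < r -> Rabs (A x0 y0) <= 4 * M / r).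
  { intros r Hr.
    apply (circle_bound (div_re x0 y0 U0 V0) (div_im x0 y0 U0 V0)
      (ddiv_re x0 y0 U0 V0 (fun u v => A u v - 0) (fun u v => B u v - 0))
      (ddiv_im x0 y0 U0 V0 (fun u v => A u v - 0) (fun u v => B u v - 0))
      x0 y0 (A x0 y0)) with (r := r); trivial.
    - intros x y Hne. now apply cderiv_div.
    - intros x y Hne. now apply cderiv_div.
    - intros eps He. destruct (H x0 y0) as ([HU HV] & _).
      (* The remainders of [U] and [V] each contribute at most [eps / 3] after division by the
         squared distance; what is left keeps the inequality strict. *)
      assert (He3 : 0 < eps / 3) by lra.
      destruct (HU (mkposreal _ He3)) as [d1 H1].
      destruct (HV (mkposreal _ He3)) as [d2 H2].
      exists (Rmin d1 d2); split; [apply Rmin_pos; apply cond_pos|].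
      intros x y Hne Hx Hy.
      specialize (H1 x y). specialize (H2 x y).
      pose proof (Rmin_l d1 d2). pose proof (Rmin_r d1 d2).
      specialize (H1 ltac:(lra) ltac:(lra)). specialize (H2 ltac:(lra) ltac:(lra)).
      simpl in H1, H2.
      pose proof (sqdist_pos _ _ _ _ Hne) as Hp.
      set (e1 := U x y - U x0 y0 - (A x0 y0 * (x - x0) + - B x0 y0 * (y - y0))) in *.
      set (e2 := V x y - V x0 y0 - (B x0 y0 * (x - x0) + A x0 y0 * (y - y0))) in *.
      replace (div_re x0 y0 U0 V0 x y - A x0 y0)
        with ((e1 * (x - x0) + e2 * (y - y0)) / sqdist x0 y0 x y).
      2:{ unfold div_re, U0, V0, inv_re, inv_im, e1, e2, sqdist in *. field. lra. }
      unfold Rdiv. rewrite Rabs_mult, (Rabs_pos_eq (/ _)).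
      2:{ left; now apply Rinv_0_lt_compat. }
      apply Rmult_lt_reg_r with (sqdist x0 y0 x y); trivial.
      rewrite Rmult_assoc, Rinv_l, Rmult_1_r by lra.
      set (m := Rmax (Rabs (x - x0)) (Rabs (y - y0))) in *.
      assert (Hm1 : Rabs (x - x0) <= m) by apply Rmax_l.
      assert (Hm2 : Rabs (y - y0) <= m) by apply Rmax_r.
      assert (Hm : m ^ 2 <= sqdist x0 y0 x y).
      { unfold sqdist, m, Rmax. rewrite <- (pow2_abs (x - x0)), <- (pow2_abs (y - y0)).
        destruct (Rle_dec (Rabs (x - x0)) (Rabs (y - y0))); nra. }
      assert (Rabs (e1 * (x - x0) + e2 * (y - y0)) <= 2 * (eps / 3) * m ^ 2).
      { eapply Rle_trans; [apply Rabs_triang|]. rewrite !Rabs_mult.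
        pose proof (Rabs_pos e1). pose proof (Rabs_pos e2).
        pose proof (Rabs_pos (x - x0)). pose proof (Rabs_pos (y - y0)).
        assert (Rabs e1 * Rabs (x - x0) <= (eps / 3 * m) * m)
          by (apply Rmult_le_compat; lra).
        assert (Rabs e2 * Rabs (y - y0) <= (eps / 3 * m) * m)
          by (apply Rmult_le_compat; lra).
        lra. }
      nra.
    - intros t _.
      assert (Hs : Rabs (U0 (x0 + r * cos t) (y0 + r * sin t)) <= 2 * M /\
                   Rabs (V0 (x0 + r * cos t) (y0 + r * sin t)) <= 2 * M).
      { unfold U0, V0.
        destruct (HM (x0 + r * cos t) (y0 + r * sin t)) as [a1 a2].
        destruct (HM x0 y0) as [a3 a4].
        split; (eapply Rle_trans; [apply Rabs_triang|]); rewrite Rabs_Ropp; lra. }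
      destruct Hs as [Hs1 Hs2].
      unfold div_re, inv_re, inv_im. rewrite circle_sqdist.
      replace (x0 + r * cos t - x0) with (r * cos t) by ring.
      replace (y0 + r * sin t - y0) with (r * sin t) by ring.
      set (u := U0 _ _) in *. set (v := V0 _ _) in *.
      replace (u * (r * cos t * / r ^ 2) - v * (- (r * sin t) * / r ^ 2))
        with ((u * cos t + v * sin t) * / r) by (field; lra).
      rewrite Rabs_mult, (Rabs_pos_eq (/ r)) by (left; now apply Rinv_0_lt_compat).
      apply Rmult_le_compat_r; [left; now apply Rinv_0_lt_compat|].
      eapply Rle_trans; [apply Rabs_triang|]. rewrite !Rabs_mult.
      assert (Rabs (cos t) <= 1) by (apply Rabs_le; apply COS_bound).
      assert (Rabs (sin t) <= 1) by (apply Rabs_le; apply SIN_bound).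
      pose proof (Rabs_pos u). pose proof (Rabs_pos v).
      pose proof (Rabs_pos (cos t)). pose proof (Rabs_pos (sin t)).
      assert (Rabs u * Rabs (cos t) <= 2 * M * 1) by (apply Rmult_le_compat; lra).
      assert (Rabs v * Rabs (sin t) <= 2 * M * 1) by (apply Rmult_le_compat; lra).
      lra. }
  destruct (Req_dec (A x0 y0) 0) as [|N]; trivial. exfalso.
  assert (Hp : 0 < Rabs (A x0 y0)) by now apply Rabs_pos_lt.
  set (a := Rabs (A x0 y0)) in *.
  (* At this radius the bound is [a] times [4 * M / (4 * M + 1)], which is less than [a]; the added
     1 keeps the radius positive when [M = 0]. *)
  assert (Hr : 0 < (4 * M + 1) / a) by (apply Rdiv_lt_0_compat; lra).
  specialize (key _ Hr).
  replace (4 * M / ((4 * M + 1) / a)) with (a * (4 * M / (4 * M + 1))) in key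
    by (field; lra).
  assert (4 * M / (4 * M + 1) < 1).
  { apply Rmult_lt_reg_r with (4 * M + 1); [lra|]. unfold Rdiv.
    rewrite Rmult_assoc, Rinv_l; lra. }
  nra.
Qed.

Lemma liouville (U V A B : R -> R -> R) (M : R) :
  entire U V A B -> (forall x y, Rabs (U x y) <= M /\ Rabs (V x y) <= M) ->
  forall x y, A x y = 0 /\ B x y = 0.
Proof.
  intros H HM x y; split.
  - exact (liouville_re U V A B M H HM x y).
  - apply (liouville_re _ _ _ _ M (entire_rot _ _ _ _ H)).
    intros u v; rewrite Rabs_Ropp. destruct (HM u v); now split.
Qed.

Lemma entire_mean_bound (U V A B : R -> R -> R) (x0 y0 r M : R) :
  entire U V A B -> 0 < r ->
  (forall t, 0 <= t <= 2 * PI -> Rabs (U (x0 + r * cos t) (y0 + r * sin t)) <= M) ->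
  Rabs (U x0 y0) <= M.
Proof.
  intros H Hr HM.
  apply (circle_bound U V A B x0 y0 (U x0 y0)) with (r := r); trivial.
  - intros; apply H.
  - intros; apply H.
  - intros eps He.
    destruct (entire_cont _ _ _ _ H x0 y0) as [HU _].
    destruct (HU (mkposreal eps He)) as [d Hd].
    exists d; split; [apply cond_pos|]. intros x y _. apply Hd.
Qed.

(** * Unique continuation from a square *)

Definition vanish_near (x1 y1 d : R) (U : R -> R -> R) : Prop :=
  forall x y, Rabs (x - x1) < d -> Rabs (y - y1) < d -> U x y = 0.

Lemma box_open (x1 y1 d x y : R) :
  Rabs (x - x1) < d -> Rabs (y - y1) < d ->
  locally_2d (fun u v => Rabs (u - x1) < d /\ Rabs (v - y1) < d) x y.
Proof.
  intros Hx Hy.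
  assert (Hm : 0 < Rmin (d - Rabs (x - x1)) (d - Rabs (y - y1)))
    by (apply Rmin_pos; lra).
  exists (mkposreal _ Hm); simpl; intros u v Hu Hv.
  pose proof (Rmin_l (d - Rabs (x - x1)) (d - Rabs (y - y1))).
  pose proof (Rmin_r (d - Rabs (x - x1)) (d - Rabs (y - y1))).
  split.
  - replace (u - x1) with ((u - x) + (x - x1)) by ring.
    eapply Rle_lt_trans; [apply Rabs_triang|]; lra.
  - replace (v - y1) with ((v - y) + (y - y1)) by ring.
    eapply Rle_lt_trans; [apply Rabs_triang|]; lra.
Qed.

Lemma box_center (x1 y1 d x y : R) :
  0 < d -> ~ (x <> x1 \/ y <> y1) -> Rabs (x - x1) < d /\ Rabs (y - y1) < d.
Proof.
  intros Hd H.
  assert (Ex : x = x1) by (apply NNPP; tauto).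
  assert (Ey : y = y1) by (apply NNPP; tauto).
  subst; unfold Rminus; rewrite !Rplus_opp_r, Rabs_R0; now split.
Qed.

Lemma vanish_cont (x1 y1 d : R) (U : R -> R -> R) (x y : R) :
  vanish_near x1 y1 d U -> Rabs (x - x1) < d -> Rabs (y - y1) < d ->
  continuity_2d_pt U x y.
Proof.
  intros HU Hx Hy.
  destruct (box_open x1 y1 d x y Hx Hy) as [e He].
  apply (continuity_2d_pt_ext_loc (fun _ _ => 0)); [|apply continuity_2d_pt_const].
  exists e; intros u v Hu Hv; destruct (He u v Hu Hv).
  symmetry; now apply HU.
Qed.

Lemma vanish_dpl (x1 y1 d : R) (U : R -> R -> R) (x y : R) :
  vanish_near x1 y1 d U -> Rabs (x - x1) < d -> Rabs (y - y1) < d ->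
  differentiable_pt_lim U x y 0 0.
Proof.
  intros HU Hx Hy.
  destruct (box_open x1 y1 d x y Hx Hy) as [e He].
  apply (differentiable_pt_lim_ext (fun _ _ => 0)); [|apply dpl_const].
  exists e; intros u v Hu Hv; destruct (He u v Hu Hv).
  symmetry; now apply HU.
Qed.

Lemma vanish_deriv (x1 y1 d : R) (U V A B : R -> R -> R) :
  entire U V A B -> vanish_near x1 y1 d U ->
  vanish_near x1 y1 d A /\ vanish_near x1 y1 d B.
Proof.
  intros H HU; split; intros x y Hx Hy;
    destruct (H x y) as ([HD _] & _);
    destruct (differentiable_pt_lim_unique _ _ _ _ _ HD) as [E1 E2];
    destruct (differentiable_pt_lim_unique _ _ _ _ _
      (vanish_dpl _ _ _ _ _ _ HU Hx Hy)) as [E3 E4]; lra.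
Qed.

(** The numerator is zero on the whole square, so the quotient is zero there too, the centre
    included whatever the inverse of 0 is. No removable singularity has to be treated, and the
    hypotheses reproduce themselves, which permits repeated division. *)
Lemma entire_div (x1 y1 d : R) (U V A B : R -> R -> R) :
  0 < d -> entire U V A B -> vanish_near x1 y1 d U -> vanish_near x1 y1 d V ->
  entire (div_re x1 y1 U V) (div_im x1 y1 U V)
         (ddiv_re x1 y1 U V A B) (ddiv_im x1 y1 U V A B) /\
  vanish_near x1 y1 d (div_re x1 y1 U V) /\ vanish_near x1 y1 d (div_im x1 y1 U V).
Proof.
  intros Hd H HU HV.
  destruct (vanish_deriv _ _ _ _ _ _ _ H HU) as [HA HB].
  assert (N1 : vanish_near x1 y1 d (div_re x1 y1 U V)).
  { intros x y Hx Hy; unfold div_re; rewrite (HU x y Hx Hy), (HV x y Hx Hy); ring. }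
  assert (N2 : vanish_near x1 y1 d (div_im x1 y1 U V)).
  { intros x y Hx Hy; unfold div_im; rewrite (HU x y Hx Hy), (HV x y Hx Hy); ring. }
  assert (N3 : vanish_near x1 y1 d (ddiv_re x1 y1 U V A B)).
  { intros x y Hx Hy; unfold ddiv_re.
    rewrite (HU x y Hx Hy), (HV x y Hx Hy), (HA x y Hx Hy), (HB x y Hx Hy); ring. }
  assert (N4 : vanish_near x1 y1 d (ddiv_im x1 y1 U V A B)).
  { intros x y Hx Hy; unfold ddiv_im.
    rewrite (HU x y Hx Hy), (HV x y Hx Hy), (HA x y Hx Hy), (HB x y Hx Hy); ring. }
  repeat split; trivial.
  all: destruct (classic (x <> x1 \/ y <> y1)) as [Hne|Hne];
    [now apply (cderiv_div x1 y1 U V A B H x y Hne)|].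
  all: destruct (box_center _ _ _ _ _ Hd Hne) as [Hx Hy].
  - eapply dpl_eq; [eapply vanish_dpl; eassumption| |].
    + symmetry; now apply N3.
    + rewrite N4; trivial; ring.
  - eapply dpl_eq; [eapply vanish_dpl; eassumption| |].
    + symmetry; now apply N4.
    + symmetry; now apply N3.
  - eapply vanish_cont; eassumption.
  - eapply vanish_cont; eassumption.
Qed.

(* An entire function vanishing near [z1] can be divided by [(z - z1)^n]; at a
   point [w] the mean value property of the quotient on the circle of radius
   [3|w - z1|] gives [|h w| <= C / 2^n]. *)
Lemma entire_vanish (x1 y1 d : R) (U V A B : R -> R -> R) :
  0 < d -> entire U V A B -> vanish_near x1 y1 d U -> vanish_near x1 y1 d V ->
  forall x y, U x y = 0 /\ V x y = 0.
Proof.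
  intros Hd H HU HV x y.
  destruct (classic (x <> x1 \/ y <> y1)) as [Hne|Hne].
  2:{ destruct (box_center _ _ _ _ _ Hd Hne). split; auto. }
  pose proof (sqdist_pos _ _ _ _ Hne) as Hp.
  (* Only the squared modulus of the [n]-fold quotient is recorded; it is all the estimate uses, and
     it avoids complex powers. *)
  assert (Hq : forall n, exists Un Vn An Bn, entire Un Vn An Bn /\
    vanish_near x1 y1 d Un /\ vanish_near x1 y1 d Vn /\
    forall u v, u <> x1 \/ v <> y1 ->
      (Un u v ^ 2 + Vn u v ^ 2) * sqdist x1 y1 u v ^ n = U u v ^ 2 + V u v ^ 2).
  { induction n as [|n (Un & Vn & An & Bn & E1 & E2 & E3 & E4)].
    - exists U, V, A, B; repeat split; trivial; try apply H. intros; simpl; ring.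
    - destruct (entire_div x1 y1 d Un Vn An Bn Hd E1 E2 E3) as (F1 & F2 & F3).
      do 4 eexists; split; [exact F1|split; [exact F2|split; [exact F3|]]].
      intros u v Huv. rewrite <- (E4 u v Huv), <- (div_sqmod x1 y1 Un Vn u v Huv).
      simpl; ring. }
  set (rho := sqrt (sqdist x1 y1 x y)).
  assert (Hrho : 0 < rho) by now apply sqrt_lt_R0.
  assert (Hrho2 : rho ^ 2 = sqdist x1 y1 x y) by (apply pow2_sqrt; lra).
  set (cx := fun t => x + 3 * rho * cos t). set (cy := fun t => y + 3 * rho * sin t).
  set (g := fun t => U (cx t) (cy t) ^ 2 + V (cx t) (cy t) ^ 2).
  (* The circle stays at distance at least [2 * rho] from [z1], while its centre is at distance
     [rho]. Each division gains this ratio 2, that is, 4 in squared moduli. *)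
  assert (far : forall t, 4 * rho ^ 2 <= sqdist x1 y1 (cx t) (cy t)).
  { intros t. unfold sqdist, cx, cy in *.
    pose proof (circle_sqdist x y (3 * rho) t) as Hc. unfold sqdist in Hc.
    set (p := x - x1) in *. set (q := y - y1) in *.
    replace (x + 3 * rho * cos t - x) with (3 * rho * cos t) in Hc by ring.
    replace (y + 3 * rho * sin t - y) with (3 * rho * sin t) in Hc by ring.
    replace (x + 3 * rho * cos t - x1) with (p + 3 * rho * cos t) by (unfold p; ring).
    replace (y + 3 * rho * sin t - y1) with (q + 3 * rho * sin t) by (unfold q; ring).
    set (a := 3 * rho * cos t) in *. set (b := 3 * rho * sin t) in *.
    (* [|p + a| >= 3 rho - rho] by Cauchy-Schwarz *)
    assert (CS : (p * a + q * b) ^ 2 <= (3 * rho ^ 2) ^ 2).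
    { replace ((3 * rho ^ 2) ^ 2) with (rho ^ 2 * (3 * rho) ^ 2) by ring.
      rewrite Hrho2, <- Hc. pose proof (pow2_ge_0 (p * b - q * a)); nra. }
    assert (- (3 * rho ^ 2) <= p * a + q * b) by (pose proof (pow2_ge_0 rho); nra).
    nra. }
  assert (cne : forall t, cx t <> x1 \/ cy t <> y1).
  { intros t. destruct (Req_dec (cx t) x1) as [e1|]; [|now left].
    destruct (Req_dec (cy t) y1) as [e2|]; [|now right]. exfalso.
    pose proof (far t) as Hf. unfold sqdist in Hf. rewrite e1, e2 in Hf. nra. }
  assert (Hg : exists M, 0 <= M /\ forall t, 0 <= t <= 2 * PI -> g t <= M ^ 2).
  { pose proof PI_RGT_0.
    destruct (continuity_ab_maj g 0 (2 * PI)) as [m [Hm _]]; [lra| |].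
    - intros t _. apply continuity_pt_filterlim. unfold g.
      assert (Hcx : continuous cx t).
      { apply (ex_derive_continuous cx); unfold cx; auto_derive; trivial. }
      assert (Hcy : continuous cy t).
      { apply (ex_derive_continuous cy); unfold cy; auto_derive; trivial. }
      destruct (entire_cont _ _ _ _ H (cx t) (cy t)) as [HcU HcV].
      apply (cont2_curve (fun a b => U a b ^ 2 + V a b ^ 2) cx cy); trivial.
      simpl; cont2.
    - exists (sqrt (g m)); split; [apply sqrt_pos|].
      intros t Ht. rewrite pow2_sqrt; [now apply Hm|].
      unfold g; pose proof (pow2_ge_0 (U (cx m) (cy m)));
      pose proof (pow2_ge_0 (V (cx m) (cy m))); lra. }
  destruct Hg as [M [HM0 HM]].
  assert (key : forall n, (U x y ^ 2 + V x y ^ 2) * 4 ^ n <= 2 * M ^ 2).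
  { intros n. destruct (Hq n) as (Un & Vn & An & Bn & E1 & _ & _ & E4).
    assert (Hpn : 0 < (2 * rho) ^ n) by (apply pow_lt; lra).
    assert (Hsq : ((2 * rho) ^ n) ^ 2 = (4 * rho ^ 2) ^ n).
    { rewrite <- pow_mult, Nat.mul_comm, pow_mult. f_equal; ring. }
    set (m := M / (2 * rho) ^ n).
    assert (Hm0 : 0 <= m) by (apply Rdiv_le_0_compat; trivial).
    assert (Hm : m ^ 2 * (4 * rho ^ 2) ^ n = M ^ 2).
    { rewrite <- Hsq. unfold m. field. lra. }
    assert (Hbd : forall t, 0 <= t <= 2 * PI ->
      Un (cx t) (cy t) ^ 2 + Vn (cx t) (cy t) ^ 2 <= m ^ 2).
    { intros t Ht.
      apply Rmult_le_reg_r with ((4 * rho ^ 2) ^ n); [apply pow_lt; nra|].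
      rewrite Hm. eapply Rle_trans; [|apply (HM t Ht)].
      unfold g. rewrite <- (E4 _ _ (cne t)).
      apply Rmult_le_compat_l.
      - pose proof (pow2_ge_0 (Un (cx t) (cy t)));
        pose proof (pow2_ge_0 (Vn (cx t) (cy t))); lra.
      - apply pow_incr; split; [nra|apply far]. }
    assert (b1 : Rabs (Un x y) <= m).
    { apply (entire_mean_bound Un Vn An Bn x y (3 * rho)); trivial; [lra|].
      intros t Ht. apply Rabs_le_of_sq; trivial. fold (cx t) (cy t).
      pose proof (Hbd t Ht). pose proof (pow2_ge_0 (Vn (cx t) (cy t))); lra. }
    assert (b2 : Rabs (Vn x y) <= m).
    { apply (entire_mean_bound _ _ _ _ x y (3 * rho) m (entire_rot _ _ _ _ E1)); [lra|].
      intros t Ht. apply Rabs_le_of_sq; trivial. fold (cx t) (cy t).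
      pose proof (Hbd t Ht). pose proof (pow2_ge_0 (Un (cx t) (cy t))); lra. }
    rewrite <- (E4 x y Hne), <- Hm, <- Hrho2, Rpow_mult_distr.
    assert (Un x y ^ 2 <= m ^ 2)
      by (rewrite <- pow2_abs; apply pow_incr; split; trivial; apply Rabs_pos).
    assert (Vn x y ^ 2 <= m ^ 2)
      by (rewrite <- pow2_abs; apply pow_incr; split; trivial; apply Rabs_pos).
    assert (0 < 4 ^ n) by (apply pow_lt; lra).
    assert (0 < (rho ^ 2) ^ n) by (apply pow_lt; nra).
    assert (0 < 4 ^ n * (rho ^ 2) ^ n) by now apply Rmult_lt_0_compat.
    nra. }
  assert (Z : U x y ^ 2 + V x y ^ 2 = 0).
  { pose proof (pow2_ge_0 (U x y)). pose proof (pow2_ge_0 (V x y)).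
    set (s := U x y ^ 2 + V x y ^ 2) in *.
    destruct (Req_dec s 0) as [|N]; trivial. exfalso.
    assert (Hs : 0 < s) by (unfold s in *; lra).
    destruct (Pow_x_infinity 4) with (b := (2 * M ^ 2 + 1) / s) as [n Hn].
    { rewrite Rabs_pos_eq; lra. }
    specialize (Hn n (Nat.le_refl n)). rewrite Rabs_pos_eq in Hn
      by (apply pow_le; lra).
    specialize (key n).
    assert ((2 * M ^ 2 + 1) / s * s = 2 * M ^ 2 + 1) by (field; lra). nra. }
  pose proof (pow2_ge_0 (U x y)). pose proof (pow2_ge_0 (V x y)).
  split; nra.
Qed.

(** * Jörgens' theorem *)

(** Strong monotonicity carries [f] past [s] on both sides within distance [N] of 0, and the
    intermediate value theorem applies. The root is kept as a sigma type, so that the inverse of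
    Lewy's map can be defined as a function. *)
Lemma expanding_surj (f : R -> R) (s : R) :
  continuity f -> (forall x y, (x - y) ^ 2 <= (f x - f y) * (x - y)) ->
  {x : R | f x = s}.
Proof.
  intros Hc Hm.
  set (N := Rabs (s - f 0) + 1).
  assert (HN : 0 < N) by (pose proof (Rabs_pos (s - f 0)); unfold N; lra).
  assert (Hs : f 0 - N < s < f 0 + N).
  { unfold N. pose proof (Rle_abs (s - f 0)). pose proof (Rle_abs (- (s - f 0))).
    rewrite Rabs_Ropp in *. lra. }
  assert (H1 : f 0 + N <= f N) by (pose proof (Hm N 0); nra).
  assert (H2 : f (- N) <= f 0 - N) by (pose proof (Hm (- N) 0); nra).
  destruct (IVT_gen f (- N) N s Hc) as [x [_ Hx]].
  - rewrite Rmin_left, Rmax_right; lra.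
  - now exists x.
Qed.

Lemma is_derive_lin (f g : R -> R) (t f' g' p q : R) :
  is_derive f t f' -> is_derive g t g' ->
  is_derive (fun s => f s * p + g s * q) t (f' * p + g' * q).
Proof.
  intros Hf Hg.
  apply (is_derive_plus (fun s => f s * p) (fun s => g s * q)).
  - exact (is_derive_scal_l f t f' p Hf).
  - exact (is_derive_scal_l g t g' q Hg).
Qed.

Lemma entire_shift (U V A B : R -> R -> R) (a b : R) :
  entire U V A B ->
  entire (fun x y => U (x + a) (y + b)) (fun x y => V (x + a) (y + b))
         (fun x y => A (x + a) (y + b)) (fun x y => B (x + a) (y + b)).
Proof.
  intros H x y.
  destruct (H (x + a) (y + b)) as ([HU HV] & HA & HB).
  assert (Hx : differentiable_pt_lim (fun u _ : R => u + a) x y 1 0).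
  { eapply dpl_eq; [apply dpl_plus; [apply dpl_fst|apply dpl_const]|ring|ring]. }
  assert (Hy : differentiable_pt_lim (fun _ v : R => v + b) x y 0 1).
  { eapply dpl_eq; [apply dpl_plus; [apply dpl_snd|apply dpl_const]|ring|ring]. }
  split; [split|split].
  - eapply dpl_eq.
    + apply (differentiable_pt_lim_comp U _ _ x y _ _ _ _ _ _ HU Hx Hy).
    + ring.
    + ring.
  - eapply dpl_eq.
    + apply (differentiable_pt_lim_comp V _ _ x y _ _ _ _ _ _ HV Hx Hy).
    + ring.
    + ring.
  - apply (cont2_comp A (fun u _ => u + a) (fun _ v => v + b)); trivial; cont2.
  - apply (cont2_comp B (fun u _ => u + a) (fun _ v => v + b)); trivial; cont2.
Qed.

Lemma entire_minus (U1 V1 A1 B1 U2 V2 A2 B2 : R -> R -> R) :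
  entire U1 V1 A1 B1 -> entire U2 V2 A2 B2 ->
  entire (fun u v => U1 u v - U2 u v) (fun u v => V1 u v - V2 u v)
         (fun u v => A1 u v - A2 u v) (fun u v => B1 u v - B2 u v).
Proof.
  intros H1 H2 x y.
  destruct (H1 x y) as (D1 & C1 & C2), (H2 x y) as (D2 & C3 & C4).
  split; [now apply cderiv_minus|split; cont2].
Qed.

Section Jorgens.

(** [(A, B)] is the gradient of the potential [phi] and [a], [b], [c] are the entries of its
    Hessian; [phi] itself never appears. *)
Variables A B a b c : R -> R -> R.
Hypothesis dA : forall x y, differentiable_pt_lim A x y (a x y) (b x y).
Hypothesis dB : forall x y, differentiable_pt_lim B x y (b x y) (c x y).
Hypothesis Ca : forall x y, continuity_2d_pt a x y.
Hypothesis Cb : forall x y, continuity_2d_pt b x y.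
Hypothesis Cc : forall x y, continuity_2d_pt c x y.
Hypothesis apos : forall x y, 0 < a x y.
Hypothesis det1 : forall x y, a x y * c x y - b x y ^ 2 = 1.

Lemma hess_cpos x y : 0 < c x y.
Proof. pose proof (apos x y). pose proof (det1 x y). nra. Qed.

(** Along the segment, the derivative of the gradient's component in the direction of the segment is
    the Hessian quadratic form, which is nonnegative. *)
Lemma grad_monotone x y x' y' :
  0 <= (A x y - A x' y') * (x - x') + (B x y - B x' y') * (y - y').
Proof.
  set (dx := x - x'). set (dy := y - y').
  set (px := fun t => x' + t * dx). set (py := fun t => y' + t * dy).
  set (phi := fun t => A (px t) (py t) * dx + B (px t) (py t) * dy).
  set (dphi := fun t => (a (px t) (py t) * dx + b (px t) (py t) * dy) * dx
                      + (b (px t) (py t) * dx + c (px t) (py t) * dy) * dy).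
  assert (Hd : forall t, is_derive phi t (dphi t)).
  { intros t.
    assert (Hx : is_derive px t dx) by (unfold px; auto_derive; trivial; ring).
    assert (Hy : is_derive py t dy) by (unfold py; auto_derive; trivial; ring).
    unfold phi, dphi.
    pose proof (dpl_curve A px py t _ _ _ _ (dA _ _) Hx Hy) as HA.
    pose proof (dpl_curve B px py t _ _ _ _ (dB _ _) Hx Hy) as HB.
    now apply is_derive_lin. }
  destruct (MVT_gen phi 0 1 dphi) as [t [_ Ht]].
  - intros; apply Hd.
  - intros t _. apply continuity_pt_filterlim, (ex_derive_continuous phi).
    eexists; apply Hd.
  - assert (E1 : phi 1 = A x y * dx + B x y * dy).
    { unfold phi, px, py, dx, dy.
      replace (x' + 1 * (x - x')) with x by ring.
      now replace (y' + 1 * (y - y')) with y by ring. }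
    assert (E0 : phi 0 = A x' y' * dx + B x' y' * dy).
    { unfold phi, px, py.
      replace (x' + 0 * dx) with x' by ring.
      now replace (y' + 0 * dy) with y' by ring. }
    rewrite E1, E0 in Ht.
    assert (0 <= dphi t).
    { unfold dphi. set (u := px t). set (v := py t).
      pose proof (apos u v) as Hap. pose proof (det1 u v) as Hdet.
      apply Rmult_le_reg_l with (a u v); trivial.
      replace (a u v * ((a u v * dx + b u v * dy) * dx + (b u v * dx + c u v * dy) * dy))
        with ((a u v * dx + b u v * dy) ^ 2 + (a u v * c u v - b u v ^ 2) * dy ^ 2) by ring.
      rewrite Hdet. pose proof (pow2_ge_0 (a u v * dx + b u v * dy)).
      pose proof (pow2_ge_0 dy). lra. }
    lra.
Qed.

(* Lewy's map is [(x, y) |-> (x + A, y + B)]. *)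
Lemma lewy_expands x y x' y' :
  (x - x') ^ 2 + (y - y') ^ 2 <=
  (x + A x y - (x' + A x' y')) * (x - x') + (y + B x y - (y' + B x' y')) * (y - y').
Proof. pose proof (grad_monotone x y x' y'). nra. Qed.

(** Elimination reduces the claim to one variable twice. For fixed [y] the first equation has a root
    [X y]; along the curve [(X y, y)] the first component of Lewy's map is constant, so the
    expansion inequality makes the second component expanding in [y] alone. *)
Lemma lewy_onto s t : {p : R * R |
  fst p + A (fst p) (snd p) = s /\ snd p + B (fst p) (snd p) = t}.
Proof.
  assert (cx : forall y, continuity (fun x => x + A x y)).
  { intros y x. apply continuity_pt_filterlim.
    apply (ex_derive_continuous (fun x => x + A x y)).
    destruct (dpl_is_derive _ _ _ _ _ (dpl_plus _ _ _ _ _ _ _ _ (dpl_fst x y) (dA x y)))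
      as [H _].
    eexists; exact H. }
  assert (H1 : forall y, {x : R | x + A x y = s}).
  { intros y. apply (expanding_surj (fun x => x + A x y)); trivial.
    intros x x'. pose proof (lewy_expands x y x' y). nra. }
  set (X := fun y => proj1_sig (H1 y)).
  assert (HX : forall y, X y + A (X y) y = s).
  { intros y; exact (proj2_sig (H1 y)). }
  assert (HXc : forall y, continuous X y).
  { intros y0.
    assert (Hg : continuous (fun y => A (X y0) y) y0).
    { apply (ex_derive_continuous (fun y => A (X y0) y)).
      destruct (dpl_is_derive _ _ _ _ _ (dA (X y0) y0)) as [_ H].
      eexists; exact H. }
    apply continuity_pt_filterlim. apply continuity_pt_filterlim in Hg.
    intros eps He. destruct (Hg eps He) as [d [Hd Hd']].
    exists d; split; trivial. intros y Hy. specialize (Hd' y Hy).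
    unfold dist in *; simpl in *; unfold Rdist in *.
    eapply Rle_lt_trans; [|exact Hd'].
    (* Comparing two points with the same ordinate bounds the variation of [X] by that of
       [A (X y0)], a function already known to be continuous. *)
    pose proof (lewy_expands (X y) y (X y0) y) as Hl.
    pose proof (HX y). pose proof (HX y0).
    assert (Hl2 : (X y - X y0) ^ 2 <= - (A (X y0) y - A (X y0) y0) * (X y - X y0)).
    { replace (X y + A (X y) y - (X y0 + A (X y0) y))
        with (- (A (X y0) y - A (X y0) y0)) in Hl by lra.
      replace (y - y) with 0 in Hl by ring. lra. }
    set (p := X y - X y0) in *. set (q := A (X y0) y - A (X y0) y0) in *.
    rewrite <- (Rabs_Ropp q).
    apply Rsqr_le_abs_0; unfold Rsqr. pose proof (pow2_ge_0 (p + q)). lra. }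
  destruct (expanding_surj (fun y => y + B (X y) y) t) as [y Hy].
  - intros y. apply continuity_pt_filterlim.
    apply (continuous_plus (fun y => y) (fun y => B (X y) y)); [apply continuous_id|].
    apply (cont2_curve B X (fun y => y)); trivial; [|apply continuous_id].
    exact (dpl_cont _ _ _ _ _ (dB _ _)).
  - intros y y'. pose proof (lewy_expands (X y) y (X y') y') as Hl.
    rewrite !HX in Hl. pose proof (pow2_ge_0 (X y - X y')). lra.
  - exists (X y, y); simpl; split; trivial.
Qed.

(** [(S1, S2)] is the inverse of Lewy's map. *)
Let S1 s t := fst (proj1_sig (lewy_onto s t)).
Let S2 s t := snd (proj1_sig (lewy_onto s t)).

Let HS s t : S1 s t + A (S1 s t) (S2 s t) = s /\ S2 s t + B (S1 s t) (S2 s t) = t.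
Proof. exact (proj2_sig (lewy_onto s t)). Qed.

Let S_mono s t s' t' :
  (S1 s t - S1 s' t') ^ 2 + (S2 s t - S2 s' t') ^ 2 <=
  (s - s') * (S1 s t - S1 s' t') + (t - t') * (S2 s t - S2 s' t').
Proof.
  pose proof (lewy_expands (S1 s t) (S2 s t) (S1 s' t') (S2 s' t')) as H.
  destruct (HS s t) as [h1 h2], (HS s' t') as [h3 h4].
  now rewrite h1, h2, h3, h4 in H.
Qed.

(** The inverse of an expanding map is Euclidean nonexpansive. The maximum norm, in which
    differentiability is stated, costs a factor [sqrt 2], rounded up to 2. *)
Let S_lip s t s' t' :
  Rmax (Rabs (S1 s t - S1 s' t')) (Rabs (S2 s t - S2 s' t')) <=
  2 * Rmax (Rabs (s - s')) (Rabs (t - t')).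
Proof.
  pose proof (S_mono s t s' t') as H.
  set (p := S1 s t - S1 s' t') in *. set (q := S2 s t - S2 s' t') in *.
  set (m := Rmax (Rabs (s - s')) (Rabs (t - t'))).
  assert (m1 : Rabs (s - s') <= m) by apply Rmax_l.
  assert (m2 : Rabs (t - t') <= m) by apply Rmax_r.
  pose proof (Rabs_pos (s - s')). pose proof (Rabs_pos p). pose proof (Rabs_pos q).
  pose proof (Rabs_pos (t - t')).
  assert (h1 : (s - s') * p <= m * Rabs p).
  { eapply Rle_trans; [apply Rle_abs|]. rewrite Rabs_mult.
    now apply Rmult_le_compat_r. }
  assert (h2 : (t - t') * q <= m * Rabs q).
  { eapply Rle_trans; [apply Rle_abs|]. rewrite Rabs_mult.
    now apply Rmult_le_compat_r. }
  rewrite <- (pow2_abs p), <- (pow2_abs q) in H.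
  set (P := Rabs p) in *. set (Q := Rabs q) in *.
  assert (0 <= m) by lra.
  apply Rmax_lub; apply Rnot_lt_le; intros N.
  - assert (2 * m * m <= P * (P - m)) by (apply Rmult_le_compat; lra).
    pose proof (pow2_ge_0 (Q - m / 2)).
    assert (m < 0 \/ m = 0) by nra. nra.
  - assert (2 * m * m <= Q * (Q - m)) by (apply Rmult_le_compat; lra).
    pose proof (pow2_ge_0 (P - m / 2)).
    assert (m < 0 \/ m = 0) by nra. nra.
Qed.

(** Since the Hessian determinant is 1, this is the Jacobian [(1 + a) (1 + c) - b^2] of Lewy's
    map. *)
Let D x y := 2 + a x y + c x y.

(** With the inverse already Lipschitz, its differential follows by solving the first-order
    expansion of Lewy's map with Cramer's rule: an error small against the displacement in [(x, y)]
    is small against the one in [(s, t)]. *)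
Let S_dpl s t :
  differentiable_pt_lim S1 s t ((1 + c (S1 s t) (S2 s t)) / D (S1 s t) (S2 s t))
                               (- b (S1 s t) (S2 s t) / D (S1 s t) (S2 s t)) /\
  differentiable_pt_lim S2 s t (- b (S1 s t) (S2 s t) / D (S1 s t) (S2 s t))
                               ((1 + a (S1 s t) (S2 s t)) / D (S1 s t) (S2 s t)).
Proof.
  set (x0 := S1 s t). set (y0 := S2 s t).
  pose proof (apos x0 y0) as Ha. pose proof (hess_cpos x0 y0) as Hc.
  pose proof (det1 x0 y0) as Hdet.
  assert (key : forall eps : posreal, locally_2d (fun u v =>
    let m := Rmax (Rabs (u - s)) (Rabs (v - t)) in
    exists e1 e2, Rabs e1 <= eps * m /\ Rabs e2 <= eps * m /\
    u - s = (1 + a x0 y0) * (S1 u v - x0) + b x0 y0 * (S2 u v - y0) + e1 /\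
    v - t = b x0 y0 * (S1 u v - x0) + (1 + c x0 y0) * (S2 u v - y0) + e2) s t).
  { intros eps.
    (* The halves, here and in the radius below, absorb the Lipschitz constant 2 of the inverse. *)
    assert (He2 : 0 < eps / 2) by (pose proof (cond_pos eps); lra).
    destruct (dA x0 y0 (mkposreal _ He2)) as [d1 H1].
    destruct (dB x0 y0 (mkposreal _ He2)) as [d2 H2].
    assert (Hm : 0 < Rmin d1 d2 / 2).
    { apply Rdiv_lt_0_compat; [apply Rmin_pos; apply cond_pos|lra]. }
    exists (mkposreal _ Hm); simpl. intros u v Hu Hv.
    set (m := Rmax (Rabs (u - s)) (Rabs (v - t))).
    assert (Hmlt : m < Rmin d1 d2 / 2) by (unfold m, Rmax; destruct Rle_dec; trivial).
    pose proof (S_lip u v s t) as HL. fold x0 y0 m in HL.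
    set (M := Rmax (Rabs (S1 u v - x0)) (Rabs (S2 u v - y0))) in *.
    assert (M1 : Rabs (S1 u v - x0) <= M) by apply Rmax_l.
    assert (M2 : Rabs (S2 u v - y0) <= M) by apply Rmax_r.
    pose proof (Rmin_l d1 d2). pose proof (Rmin_r d1 d2).
    specialize (H1 (S1 u v) (S2 u v) ltac:(lra) ltac:(lra)).
    specialize (H2 (S1 u v) (S2 u v) ltac:(lra) ltac:(lra)).
    simpl in H1, H2. fold M in H1, H2.
    eexists. eexists. split; [|split; [|split]].
    - eapply Rle_trans; [exact H1|]. nra.
    - eapply Rle_trans; [exact H2|]. nra.
    - destruct (HS u v) as [h1 _], (HS s t) as [h2 _]. fold x0 y0 in h2. lra.
    - destruct (HS u v) as [_ h1], (HS s t) as [_ h2]. fold x0 y0 in h2. lra. }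
  assert (HD : 0 < D x0 y0) by (unfold D; lra).
  assert (Hb : Rabs (b x0 y0) <= (a x0 y0 + c x0 y0) / 2).
  { apply Rabs_le_of_sq; [lra|].
    pose proof (pow2_ge_0 (a x0 y0 - c x0 y0)). nra. }
  assert (bound : forall e p1 p2 e1 e2 m, 0 <= m -> 0 < e ->
    Rabs e1 <= e / 4 * m -> Rabs e2 <= e / 4 * m ->
    Rabs p1 + Rabs p2 <= 2 * D x0 y0 ->
    Rabs ((p1 * e1 + p2 * e2) / D x0 y0) <= e * m).
  { intros e p1 p2 e1 e2 m Hm0 Hepos G1 G2 Hp.
    unfold Rdiv. rewrite Rabs_mult, (Rabs_pos_eq (/ _))
      by (left; now apply Rinv_0_lt_compat).
    apply Rmult_le_reg_r with (D x0 y0); trivial.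
    rewrite Rmult_assoc, Rinv_l, Rmult_1_r by lra.
    eapply Rle_trans; [apply Rabs_triang|]. rewrite !Rabs_mult.
    pose proof (Rabs_pos p1). pose proof (Rabs_pos p2).
    assert (Rabs p1 * Rabs e1 <= Rabs p1 * (e / 4 * m)) by (apply Rmult_le_compat_l; lra).
    assert (Rabs p2 * Rabs e2 <= Rabs p2 * (e / 4 * m)) by (apply Rmult_le_compat_l; lra).
    assert (0 <= e * m) by (apply Rmult_le_pos; lra).
    nra. }
  split; intros eps;
    (assert (He4 : 0 < eps / 4) by (pose proof (cond_pos eps); lra));
    destruct (key (mkposreal _ He4)) as [d Hd]; exists d; intros u v Hu Hv;
    destruct (Hd u v Hu Hv) as (e1 & e2 & G1 & G2 & G3 & G4); simpl in G1, G2;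
    fold x0 y0; set (m := Rmax (Rabs (u - s)) (Rabs (v - t))) in *;
    (assert (Hm0 : 0 <= m) by (eapply Rle_trans; [apply Rabs_pos|apply Rmax_l]));
    rewrite G3, G4.
  - match goal with |- Rabs ?e <= _ =>
      replace e with ((- (1 + c x0 y0) * e1 + b x0 y0 * e2) / D x0 y0) end.
    2:{ apply Rmult_eq_reg_r with (D x0 y0); [|lra].
        field_simplify; [|lra|lra].
        assert (E : D x0 y0 = (1 + a x0 y0) * (1 + c x0 y0) - b x0 y0 ^ 2)
          by (unfold D; nra).
        rewrite E; ring. }
    apply bound; trivial; [apply cond_pos|].
    rewrite Rabs_Ropp, (Rabs_pos_eq (1 + _)) by lra. unfold D; lra.
  - match goal with |- Rabs ?e <= _ =>
      replace e with ((b x0 y0 * e1 + - (1 + a x0 y0) * e2) / D x0 y0) end.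
    2:{ apply Rmult_eq_reg_r with (D x0 y0); [|lra].
        field_simplify; [|lra|lra].
        assert (E : D x0 y0 = (1 + a x0 y0) * (1 + c x0 y0) - b x0 y0 ^ 2)
          by (unfold D; nra).
        rewrite E; ring. }
    apply bound; trivial; [apply cond_pos|].
    rewrite Rabs_Ropp, (Rabs_pos_eq (1 + _)) by lra. unfold D; lra.
Qed.

(** With [s = x + A] and [t = y + B] one has [x - A = 2 x - s] and [y - B = 2 y - t]; the sign in
    [F2] is the conjugation that makes the map holomorphic. *)
Let F1 s t := 2 * S1 s t - s.
Let F2 s t := t - 2 * S2 s t.
Let dF1 s t := (c (S1 s t) (S2 s t) - a (S1 s t) (S2 s t)) * / D (S1 s t) (S2 s t).
Let dF2 s t := 2 * b (S1 s t) (S2 s t) * / D (S1 s t) (S2 s t).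

Let Dpos x y : 0 < D x y.
Proof. pose proof (apos x y). pose proof (hess_cpos x y). unfold D; lra. Qed.

Let F_entire : entire F1 F2 dF1 dF2.
Proof.
  intros s t. destruct (S_dpl s t) as [H1 H2].
  pose proof (Dpos (S1 s t) (S2 s t)) as Hp.
  assert (cS1 := dpl_cont _ _ _ _ _ H1). assert (cS2 := dpl_cont _ _ _ _ _ H2).
  assert (ca : continuity_2d_pt (fun u v => a (S1 u v) (S2 u v)) s t)
    by (apply cont2_comp; trivial).
  assert (cb : continuity_2d_pt (fun u v => b (S1 u v) (S2 u v)) s t)
    by (apply cont2_comp; trivial).
  assert (cc : continuity_2d_pt (fun u v => c (S1 u v) (S2 u v)) s t)
    by (apply cont2_comp; trivial).
  assert (cD : continuity_2d_pt (fun u v => / D (S1 u v) (S2 u v)) s t).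
  { apply (continuity_2d_pt_inv (fun u v => D (S1 u v) (S2 u v))); [|lra].
    unfold D; cont2. }
  split; [split|split].
  - eapply dpl_eq.
    + apply dpl_minus; [apply dpl_scal, H1|apply dpl_fst].
    + unfold dF1, D in *. field. lra.
    + unfold dF2, D in *. field. lra.
  - eapply dpl_eq.
    + apply dpl_minus; [apply dpl_snd|apply dpl_scal, H2].
    + unfold dF2, D in *. field. lra.
    + unfold dF1, D in *. field. lra.
  - unfold dF1; cont2.
  - unfold dF2; cont2.
Qed.

(** For increments, [|2 S - s|^2 = |s|^2 + 4 (|S|^2 - <S, s>)], and [S_mono] says that the bracket
    is at most 0. *)
Let F_nonexp s t s' t' :
  (F1 s t - F1 s' t') ^ 2 + (F2 s t - F2 s' t') ^ 2 <= (s - s') ^ 2 + (t - t') ^ 2.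
Proof. pose proof (S_mono s t s' t'). unfold F1, F2. nra. Qed.

(** Liouville's theorem is applied to [F (z + w) - F z], which is bounded by [|w|] for a fixed shift
    [w]. Applying it to the derivative of [F] would ask for a second complex derivative. *)
Let dF_const s t s' t' : dF1 s t = dF1 s' t' /\ dF2 s t = dF2 s' t'.
Proof.
  set (u := s - s'). set (v := t - t').
  set (M := sqrt (u ^ 2 + v ^ 2)).
  assert (HM : M ^ 2 = u ^ 2 + v ^ 2).
  { apply pow2_sqrt. pose proof (pow2_ge_0 u). pose proof (pow2_ge_0 v). lra. }
  assert (HM0 : 0 <= M) by apply sqrt_pos.
  destruct (liouville _ _ _ _ M
    (entire_minus _ _ _ _ _ _ _ _ (entire_shift _ _ _ _ u v F_entire) F_entire))
    with (x := s') (y := t') as [E1 E2].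
  - intros x y. pose proof (F_nonexp (x + u) (y + v) x y) as Hn.
    replace (x + u - x) with u in Hn by ring.
    replace (y + v - y) with v in Hn by ring.
    pose proof (pow2_ge_0 (F1 (x + u) (y + v) - F1 x y)).
    pose proof (pow2_ge_0 (F2 (x + u) (y + v) - F2 x y)).
    split; apply Rabs_le_of_sq; trivial; lra.
  - unfold u, v in E1, E2.
    replace (s' + (s - s')) with s in * by ring.
    replace (t' + (t - t')) with t in * by ring. lra.
Qed.

(** Expansion makes Lewy's map injective, so the constancy of the derivative of [F] can be read in
    [(x, y)]. Its modulus determines [a + c], and then its components determine [c - a] and [b]. *)
Lemma jorgens x y x' y' : a x y = a x' y' /\ b x y = b x' y' /\ c x y = c x' y'.
Proof.
  assert (inv : forall x y, S1 (x + A x y) (y + B x y) = x /\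
                            S2 (x + A x y) (y + B x y) = y).
  { intros p q. destruct (HS (p + A p q) (q + B p q)) as [h1 h2].
    pose proof (lewy_expands (S1 (p + A p q) (q + B p q)) (S2 (p + A p q) (q + B p q)) p q)
      as Hl.
    rewrite h1, h2 in Hl.
    set (u := S1 _ _) in *. set (v := S2 _ _) in *.
    pose proof (pow2_ge_0 (u - p)). pose proof (pow2_ge_0 (v - q)).
    split; nra. }
  destruct (dF_const (x + A x y) (y + B x y) (x' + A x' y') (y' + B x' y')) as [E1 E2].
  unfold dF1, dF2 in E1, E2.
  destruct (inv x y) as [i1 i2], (inv x' y') as [i3 i4].
  rewrite i1, i2, i3, i4 in E1, E2.
  pose proof (Dpos x y) as P1. pose proof (Dpos x' y') as P2.
  pose proof (det1 x y) as d1. pose proof (det1 x' y') as d2.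
  pose proof (apos x y). pose proof (apos x' y').
  pose proof (hess_cpos x y). pose proof (hess_cpos x' y').
  (* [(s - 2)/(s + 2)] is the squared modulus of the constant derivative,
     where [s = a + c] is the trace *)
  assert (K1 : forall u v, ((c u v - a u v) * / D u v) ^ 2 + (2 * b u v * / D u v) ^ 2
                      = 1 - 4 / D u v).
  { intros u v. pose proof (Dpos u v). pose proof (det1 u v) as dd.
    replace (((c u v - a u v) * / D u v) ^ 2 + (2 * b u v * / D u v) ^ 2)
      with (((c u v + a u v) ^ 2 - 4 * (a u v * c u v - b u v ^ 2)) / (D u v ^ 2))
      by (field; lra).
    rewrite dd. unfold D in *. field. lra. }
  pose proof (K1 x y) as k1. pose proof (K1 x' y') as k2.
  rewrite E1, E2 in k1.
  assert (ED : / D x y = / D x' y') by (unfold Rdiv in *; lra).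
  rewrite ED in E1, E2.
  assert (iD : 0 < / D x' y') by now apply Rinv_0_lt_compat.
  apply Rmult_eq_reg_r in E1; [|lra]. apply Rmult_eq_reg_r in E2; [|lra].
  assert (ED2 : D x y = D x' y').
  { rewrite <- (Rinv_inv (D x y)), ED. apply Rinv_inv. }
  unfold D in ED2. lra.
Qed.

End Jorgens.

(** * The minimal surface equation *)

Lemma smooth2_dpl (g : R -> R -> R) (l : list bool) (x y : R) :
  smooth2 g ->
  differentiable_pt_lim (dpart l g) x y (dpart (true :: l) g x y) (dpart (false :: l) g x y).
Proof.
  intros H. apply (dpl_C1 (dpart l g) (dpart (true :: l) g) (dpart (false :: l) g)).
  - intros u v. destruct (H l) as [Hd _]. destruct (Hd u v) as [H1 _].
    now apply Derive_correct.
  - intros u v. destruct (H l) as [Hd _]. destruct (Hd u v) as [_ H1].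
    now apply Derive_correct.
  - intros u v. now destruct (H (true :: l)) as [_ Hc].
Qed.

Lemma smooth2_cont (g : R -> R -> R) (l : list bool) (x y : R) :
  smooth2 g -> continuity_2d_pt (dpart l g) x y.
Proof. intros H; now destruct (H l) as [_ Hc]. Qed.

Lemma smooth2_comm (g : R -> R -> R) (x y : R) :
  smooth2 g -> dpart (false :: true :: nil) g x y = dpart (true :: false :: nil) g x y.
Proof.
  intros H. symmetry.
  apply (Schwarz g x y).
  - exists (mkposreal 1 Rlt_0_1). intros u v _ _.
    destruct (H nil) as [H0 _]. destruct (H0 u v) as [h1 h2].
    destruct (H (true :: nil)) as [H1 _]. destruct (H1 u v) as [_ h3].
    destruct (H (false :: nil)) as [H2 _]. destruct (H2 u v) as [h4 _].
    repeat split; assumption.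
  - exact (smooth2_cont g (true :: false :: nil) x y H).
  - exact (smooth2_cont g (false :: true :: nil) x y H).
Qed.

(** The primitive integrates along the horizontal axis and then vertically. Differentiating the
    vertical integral in [x] gives the integral of [D], which is [P x y - P x 0] and completes the
    horizontal term. *)
Lemma closed_form_exact (P Q D : R -> R -> R) :
  (forall x y, is_derive (fun t => P x t) y (D x y)) ->
  (forall x y, is_derive (fun t => Q t y) x (D x y)) ->
  (forall x y, continuity_2d_pt P x y) ->
  (forall x y, continuity_2d_pt Q x y) ->
  (forall x y, continuity_2d_pt D x y) ->
  exists A, forall x y, differentiable_pt_lim A x y (P x y) (Q x y).
Proof.
  intros HP HQ cP cQ cD.
  assert (cP1 : forall y x, continuous (fun t => P t y) x).
  { intros y x. apply (cont2_curve P (fun t => t) (fun _ => y)); trivial.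
    apply continuous_id. apply continuous_const. }
  assert (cQ2 : forall x y, continuous (fun t => Q x t) y).
  { intros x y. apply (cont2_curve Q (fun _ => x) (fun t => t)); trivial.
    apply continuous_const. apply continuous_id. }
  assert (cD2 : forall x y, continuous (fun t => D x t) y).
  { intros x y. apply (cont2_curve D (fun _ => x) (fun t => t)); trivial.
    apply continuous_const. apply continuous_id. }
  set (A1 := fun x => RInt (fun t => P t 0) 0 x).
  set (A2 := fun x y => RInt (fun t => Q x t) 0 y).
  assert (H1 : forall x, is_derive A1 x (P x 0)).
  { intros x. apply (is_derive_RInt (fun t => P t 0) A1 0 x).
    - apply filter_forall. intros b. apply (RInt_correct (fun t => P t 0)).
      apply (ex_RInt_continuous (fun t => P t 0)). intros; apply cP1.
    - apply cP1. }
  assert (exQ : forall x y, ex_RInt (fun t => Q x t) 0 y).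
  { intros x y. apply (ex_RInt_continuous (fun t => Q x t)). intros; apply cQ2. }
  assert (H2y : forall x y, is_derive (fun t => A2 x t) y (Q x y)).
  { intros x y. apply (is_derive_RInt (fun t => Q x t) (fun t => A2 x t) 0 y).
    - apply filter_forall. intros b. apply (RInt_correct (fun t => Q x t)), exQ.
    - apply cQ2. }
  assert (H2x : forall x y, is_derive (fun t => A2 t y) x (P x y - P x 0)).
  { intros x y.
    assert (E : RInt (fun t => Derive (fun u => Q u t) x) 0 y = P x y - P x 0).
    { rewrite (RInt_ext _ (fun t => D x t)).
      2:{ intros t _. now apply is_derive_unique. }
      apply is_RInt_unique.
      apply (is_RInt_derive (fun t => P x t) (fun t => D x t)); intros; trivial. }
    rewrite <- E.
    apply (is_derive_RInt_param Q 0 y x).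
    - apply filter_forall. intros u t _. eexists; apply HQ.
    - intros t _. apply (continuity_2d_pt_ext D); trivial.
      intros u v. symmetry. now apply is_derive_unique.
    - apply filter_forall. intros u. apply exQ. }
  exists (fun x y => A1 x + A2 x y).
  apply (dpl_C1 (fun x y => A1 x + A2 x y) P Q); trivial.
  - intros x y. replace (P x y) with (P x 0 + (P x y - P x 0)) by ring.
    apply (is_derive_plus A1 (fun t => A2 t y)); trivial.
  - intros x y. replace (Q x y) with (0 + Q x y) by ring.
    apply (is_derive_plus (fun _ => A1 x) (fun t => A2 x t)); trivial.
    apply (is_derive_const (A1 x)).
Qed.

(** * First fundamental form and orthonormal frames *)

Definition gE (f1 f2 : R -> R -> R) (x y : R) : R :=
  1 + (dpart (true :: nil) f1 x y) ^ 2 + (dpart (true :: nil) f2 x y) ^ 2.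
Definition gF (f1 f2 : R -> R -> R) (x y : R) : R :=
  dpart (true :: nil) f1 x y * dpart (false :: nil) f1 x y
  + dpart (true :: nil) f2 x y * dpart (false :: nil) f2 x y.
Definition gG (f1 f2 : R -> R -> R) (x y : R) : R :=
  1 + (dpart (false :: nil) f1 x y) ^ 2 + (dpart (false :: nil) f2 x y) ^ 2.
Definition gdet (f1 f2 : R -> R -> R) (x y : R) : R :=
  gE f1 f2 x y * gG f1 f2 x y - gF f1 f2 x y ^ 2.
(** With [1 / W] as the basic quantity, later identities are polynomial modulo [iW_sq]. *)
Definition iW (f1 f2 : R -> R -> R) (x y : R) : R := / sqrt (gdet f1 f2 x y).

Lemma gE_ge1 f1 f2 x y : 1 <= gE f1 f2 x y.
Proof.
  unfold gE. pose proof (pow2_ge_0 (dpart (true :: nil) f1 x y)).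
  pose proof (pow2_ge_0 (dpart (true :: nil) f2 x y)). lra.
Qed.

Lemma gdet_ge1 f1 f2 x y : 1 <= gdet f1 f2 x y.
Proof.
  unfold gdet, gE, gF, gG.
  set (p1 := dpart (true :: nil) f1 x y). set (p2 := dpart (true :: nil) f2 x y).
  set (q1 := dpart (false :: nil) f1 x y). set (q2 := dpart (false :: nil) f2 x y).
  replace ((1 + p1 ^ 2 + p2 ^ 2) * (1 + q1 ^ 2 + q2 ^ 2) - (p1 * q1 + p2 * q2) ^ 2)
    with (1 + p1 ^ 2 + p2 ^ 2 + q1 ^ 2 + q2 ^ 2 + (p1 * q2 - p2 * q1) ^ 2) by ring.
  pose proof (pow2_ge_0 p1). pose proof (pow2_ge_0 p2). pose proof (pow2_ge_0 q1).
  pose proof (pow2_ge_0 q2). pose proof (pow2_ge_0 (p1 * q2 - p2 * q1)). lra.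
Qed.

Lemma inv_sqrt_sq (a : R) : 1 <= a -> 0 < / sqrt a /\ (/ sqrt a) ^ 2 * a = 1.
Proof.
  intros Ha. split; [apply Rinv_0_lt_compat, sqrt_lt_R0; lra|].
  rewrite pow_inv, pow2_sqrt by lra. field; lra.
Qed.

Lemma iW_pos f1 f2 x y : 0 < iW f1 f2 x y.
Proof. apply inv_sqrt_sq, gdet_ge1. Qed.

Lemma iW_sq f1 f2 x y : iW f1 f2 x y ^ 2 * gdet f1 f2 x y = 1.
Proof. apply inv_sqrt_sq, gdet_ge1. Qed.

Lemma hessX_eq f1 f2 x y u v w :
  hessX f1 f2 x y u v w =
  c3 w * (c1 u * c1 v * dpart (true :: true :: nil) f1 x y
          + c1 u * c2 v * dpart (true :: false :: nil) f1 x y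
          + c2 u * c1 v * dpart (false :: true :: nil) f1 x y
          + c2 u * c2 v * dpart (false :: false :: nil) f1 x y)
  + c4 w * (c1 u * c1 v * dpart (true :: true :: nil) f2 x y
          + c1 u * c2 v * dpart (true :: false :: nil) f2 x y
          + c2 u * c1 v * dpart (false :: true :: nil) f2 x y
          + c2 u * c2 v * dpart (false :: false :: nil) f2 x y).
Proof.
  unfold hessX, X2, dot4, coordb; cbn [fold_right map fst snd c1 c2 c3 c4]. ring.
Qed.

(* Gram-Schmidt applied to [X_x, X_y] and to the normals [(-∇f_1, 1, 0)],
   [(-∇f_2, 0, 1)]. *)
Definition gs_frame (p1 q1 p2 q2 iu iv iw : R) : frame :=
  let E := 1 + p1 ^ 2 + p2 ^ 2 in
  let F := p1 * q1 + p2 * q2 in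
  let N := 1 + p1 ^ 2 + q1 ^ 2 in
  let N' := p1 * p2 + q1 * q2 in
  mkFrame
    (mkV4 iu 0 (iu * p1) (iu * p2))
    (mkV4 (iu * iw * - F) (iu * iw * E)
       (iu * iw * (E * q1 - F * p1)) (iu * iw * (E * q2 - F * p2)))
    (mkV4 (iv * - p1) (iv * - q1) iv 0)
    (mkV4 (iv * iw * (N' * p1 - N * p2)) (iv * iw * (N' * q1 - N * q2))
       (iv * iw * - N') (iv * iw * N)).

(** The Gram determinant of the two normals equals that of [X_x], [X_y], so the same [iw] normalizes
    the second vector of both pairs. *)
Lemma gs_frame_adapted f1 f2 x y iu iv iw :
  let p1 := dpart (true :: nil) f1 x y in
  let q1 := dpart (false :: nil) f1 x y in
  let p2 := dpart (true :: nil) f2 x y in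
  let q2 := dpart (false :: nil) f2 x y in
  iu ^ 2 * gE f1 f2 x y = 1 -> iv ^ 2 * (1 + p1 ^ 2 + q1 ^ 2) = 1 ->
  iw ^ 2 * gdet f1 f2 x y = 1 ->
  adapted_frame f1 f2 x y (gs_frame p1 q1 p2 q2 iu iv iw).
Proof.
  intros p1 q1 p2 q2. unfold gdet, gE, gF, gG.
  change (dpart (true :: nil) f1 x y) with p1. change (dpart (false :: nil) f1 x y) with q1.
  change (dpart (true :: nil) f2 x y) with p2. change (dpart (false :: nil) f2 x y) with q2.
  intros Hu Hv Hw. split; [|split].
  - set (E := 1 + p1 ^ 2 + p2 ^ 2) in *. set (F := p1 * q1 + p2 * q2) in *.
    set (N := 1 + p1 ^ 2 + q1 ^ 2) in *.
    set (g := E * (1 + q1 ^ 2 + q2 ^ 2) - F ^ 2) in *.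
    intros i j Hi Hj.
    assert (Hi' : i = 1%nat \/ i = 2%nat \/ i = 3%nat \/ i = 4%nat) by lia.
    assert (Hj' : j = 1%nat \/ j = 2%nat \/ j = 3%nat \/ j = 4%nat) by lia.
    destruct Hi' as [-> | [-> | [-> | ->]]]; destruct Hj' as [-> | [-> | [-> | ->]]];
      cbn [fvec gs_frame fe1 fe2 fxi3 fxi4 Nat.eqb]; unfold dot4; cbn [c1 c2 c3 c4];
      fold E F N; try (unfold E, F, N; ring).
    + transitivity (iu ^ 2 * E); [unfold E; ring|exact Hu].
    + transitivity ((iu ^ 2 * E) * (iw ^ 2 * g)); [unfold g, E, F; ring|].
      rewrite Hu, Hw; ring.
    + transitivity (iv ^ 2 * N); [unfold N; ring|exact Hv].
    + transitivity ((iv ^ 2 * N) * (iw ^ 2 * g)); [unfold g, E, F, N; ring|].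
      rewrite Hv, Hw; ring.
  - unfold tangent, gs_frame; cbn [fe1 c1 c2 c3 c4]; split.
    + change (px f1 x y) with p1. ring.
    + change (px f2 x y) with p2. ring.
  - unfold tangent, gs_frame; cbn [fe2 c1 c2 c3 c4]; split.
    + change (px f1 x y) with p1; change (py f1 x y) with q1. ring.
    + change (px f2 x y) with p2; change (py f2 x y) with q2. ring.
Qed.

(** The trace over an orthonormal tangent pair is contraction with the inverse metric, which gives
    [iw^2 (G r - 2 F m + E t)] for each component. The normal [fxi3] has fourth entry 0 and isolates
    the equation for [f1]; [fxi4] then gives the one for [f2]. *)
Lemma minimal_surface_equation f1 f2 :
  smooth2 f1 -> smooth2 f2 -> minimal_graph f1 f2 -> forall x y,
  (gG f1 f2 x y * dpart (true :: true :: nil) f1 x y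
   - 2 * gF f1 f2 x y * dpart (true :: false :: nil) f1 x y
   + gE f1 f2 x y * dpart (false :: false :: nil) f1 x y = 0) /\
  (gG f1 f2 x y * dpart (true :: true :: nil) f2 x y
   - 2 * gF f1 f2 x y * dpart (true :: false :: nil) f2 x y
   + gE f1 f2 x y * dpart (false :: false :: nil) f2 x y = 0).
Proof.
  intros s1 s2 Hm x y.
  pose proof (iW_sq f1 f2 x y) as Hw. pose proof (iW_pos f1 f2 x y) as Hwp.
  pose proof (gE_ge1 f1 f2 x y) as HE.
  set (p1 := dpart (true :: nil) f1 x y). set (q1 := dpart (false :: nil) f1 x y).
  set (p2 := dpart (true :: nil) f2 x y). set (q2 := dpart (false :: nil) f2 x y).
  assert (HN : 1 <= 1 + p1 ^ 2 + q1 ^ 2)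
    by (pose proof (pow2_ge_0 p1); pose proof (pow2_ge_0 q1); lra).
  destruct (inv_sqrt_sq _ HE) as [Hup Hu]. destruct (inv_sqrt_sq _ HN) as [Hvp Hv].
  set (iu := / sqrt (gE f1 f2 x y)) in *.
  set (iv := / sqrt (1 + p1 ^ 2 + q1 ^ 2)) in *.
  set (iw := iW f1 f2 x y) in *.
  destruct (Hm x y _ (gs_frame_adapted f1 f2 x y iu iv iw Hu Hv Hw)) as [T3 T4].
  unfold hcoef in T3, T4. rewrite !hessX_eq, !smooth2_comm in T3, T4 by trivial.
  fold p1 q1 p2 q2 in T3, T4.
  cbn [fvec gs_frame fe1 fe2 fxi3 fxi4 c1 c2 c3 c4] in T3, T4.
  unfold gdet in Hw.
  assert (EE : gE f1 f2 x y = 1 + p1 ^ 2 + p2 ^ 2) by reflexivity.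
  assert (EF : gF f1 f2 x y = p1 * q1 + p2 * q2) by reflexivity.
  rewrite <- EE, <- EF in T3, T4.
  set (E := gE f1 f2 x y) in *. set (F := gF f1 f2 x y) in *. set (G := gG f1 f2 x y) in *.
  set (N := 1 + p1 ^ 2 + q1 ^ 2) in *. set (N' := p1 * p2 + q1 * q2) in *.
  set (r1 := dpart (true :: true :: nil) f1 x y) in *.
  set (t1 := dpart (false :: false :: nil) f1 x y) in *.
  set (r2 := dpart (true :: true :: nil) f2 x y) in *.
  set (t2 := dpart (false :: false :: nil) f2 x y) in *.
  set (m1 := dpart (true :: false :: nil) f1 x y) in *.
  set (m2 := dpart (true :: false :: nil) f2 x y) in *.
  assert (tr : forall r m t,
    iu * iu * r + iu * 0 * m + 0 * iu * m + 0 * 0 * t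
    + (iu * iw * - F * (iu * iw * - F) * r + iu * iw * - F * (iu * iw * E) * m
       + iu * iw * E * (iu * iw * - F) * m + iu * iw * E * (iu * iw * E) * t)
    = iw ^ 2 * (G * r - 2 * F * m + E * t)).
  { intros r m t.
    transitivity (iu ^ 2 * ((iw ^ 2 * (E * G - F ^ 2)) * r)
      + iu ^ 2 * iw ^ 2 * (F ^ 2 * r - 2 * E * F * m + E ^ 2 * t)).
    - rewrite Hw; ring.
    - transitivity ((iu ^ 2 * E) * (iw ^ 2 * (G * r - 2 * F * m + E * t))); [ring|].
      rewrite Hu; ring. }
  pose proof (tr r1 m1 t1) as tr1. pose proof (tr r2 m2 t2) as tr2.
  set (M1 := G * r1 - 2 * F * m1 + E * t1) in *.
  set (M2 := G * r2 - 2 * F * m2 + E * t2) in *.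
  assert (Z1 : iv * (iw ^ 2 * M1) = 0) by (rewrite <- tr1; lra).
  assert (Hw2 : 0 < iw ^ 2) by (apply pow_lt; lra).
  assert (M10 : M1 = 0).
  { apply Rmult_integral in Z1. destruct Z1 as [Z1|Z1]; [lra|].
    apply Rmult_integral in Z1. destruct Z1; lra. }
  split; trivial.
  assert (Z2 : iv * iw * N * (iw ^ 2 * M2) = iv * iw * N' * (iw ^ 2 * M1))
    by (rewrite <- tr1, <- tr2; lra).
  rewrite M10, Rmult_0_r, Rmult_0_r in Z2.
  assert (0 < iv * iw * N) by (repeat apply Rmult_lt_0_compat; lra).
  apply Rmult_integral in Z2. destruct Z2 as [Z2|Z2]; [lra|].
  apply Rmult_integral in Z2. destruct Z2; lra.
Qed.

(** * Curvature of a minimal graph *)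

(** [U1], [V1], [U2], [V2] are the derivatives [f_uu] and [f_uv] of the two components in the
    isothermal coordinates. Minimality replaces each [h_22] by [- h_11], which turns [K] into minus
    a sum of squares and [K_N] into a multiple of the determinant [U1 V2 - U2 V1]. *)
Lemma curvature_ratio f1 f2 x y :
  smooth2 f1 -> smooth2 f2 -> minimal_graph f1 f2 ->
  let E := gE f1 f2 x y in let F := gF f1 f2 x y in let G := gG f1 f2 x y in
  let iw := iW f1 f2 x y in
  let U1 := dpart (true :: true :: nil) f1 x y in
  let U2 := dpart (true :: true :: nil) f2 x y in
  let V1 := iw * (E * dpart (true :: false :: nil) f1 x y - F * U1) in
  let V2 := iw * (E * dpart (true :: false :: nil) f2 x y - F * U2) in
  let S := U1 ^ 2 + V1 ^ 2 + U2 ^ 2 + V2 ^ 2 in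
  0 < S -> exists fr, adapted_frame f1 f2 x y fr /\ gaussK f1 f2 x y fr < 0 /\
    Rabs (normalK f1 f2 x y fr) / Rabs (gaussK f1 f2 x y fr) <=
    (E + G) * iw * (2 * Rabs (U1 * V2 - U2 * V1) / S).
Proof.
  intros s1 s2 Hm E F G iw U1 U2 V1 V2 S HS.
  pose proof (iW_sq f1 f2 x y) as Hw. pose proof (iW_pos f1 f2 x y) as Hwp.
  pose proof (gE_ge1 f1 f2 x y) as HE.
  set (p1 := dpart (true :: nil) f1 x y). set (q1 := dpart (false :: nil) f1 x y).
  set (p2 := dpart (true :: nil) f2 x y). set (q2 := dpart (false :: nil) f2 x y).
  assert (HN : 1 <= 1 + p1 ^ 2 + q1 ^ 2)
    by (pose proof (pow2_ge_0 p1); pose proof (pow2_ge_0 q1); lra).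
  destruct (inv_sqrt_sq _ HE) as [Hup Hu]. destruct (inv_sqrt_sq _ HN) as [Hvp Hv].
  set (iu := / sqrt (gE f1 f2 x y)) in *.
  set (iv := / sqrt (1 + p1 ^ 2 + q1 ^ 2)) in *.
  fold iw in Hw, Hwp. fold E in HE, Hu.
  pose proof (gs_frame_adapted f1 f2 x y iu iv iw Hu Hv Hw) as Hfr.
  fold p1 q1 p2 q2 in Hfr.
  set (fr := gs_frame p1 q1 p2 q2 iu iv iw) in *.
  destruct (Hm x y fr Hfr) as [T3 T4].
  set (N := 1 + p1 ^ 2 + q1 ^ 2) in *. set (N' := p1 * p2 + q1 * q2).
  set (N2 := 1 + p2 ^ 2 + q2 ^ 2).
  assert (EE : E = 1 + p1 ^ 2 + p2 ^ 2) by reflexivity.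
  assert (EF : F = p1 * q1 + p2 * q2) by reflexivity.
  assert (EG : G = 1 + q1 ^ 2 + q2 ^ 2) by reflexivity.
  assert (Hg : gdet f1 f2 x y = N * N2 - N' ^ 2).
  { unfold gdet. fold E F G. rewrite EE, EF, EG. unfold N, N2, N'. ring. }
  rewrite Hg in Hw.
  assert (HEG : E + G = N + N2) by (rewrite EE, EG; unfold N, N2; ring).
  assert (a3 : hcoef f1 f2 x y fr 3 1 1 = - (iv * iu ^ 2 * U1) /\
    hcoef f1 f2 x y fr 3 1 2 = - (iv * iu ^ 2 * V1) /\
    hcoef f1 f2 x y fr 3 2 1 = - (iv * iu ^ 2 * V1) /\
    hcoef f1 f2 x y fr 4 1 1 = - (iv * iw * iu ^ 2 * (N * U2 - N' * U1)) /\
    hcoef f1 f2 x y fr 4 1 2 = - (iv * iw * iu ^ 2 * (N * V2 - N' * V1)) /\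
    hcoef f1 f2 x y fr 4 2 1 = - (iv * iw * iu ^ 2 * (N * V2 - N' * V1))).
  { unfold hcoef. rewrite !hessX_eq, !smooth2_comm by trivial.
    cbn [fvec fr gs_frame fe1 fe2 fxi3 fxi4 c1 c2 c3 c4].
    rewrite <- EE, <- EF. fold N N'. fold U1 U2. unfold V1, V2.
    repeat split; ring. }
  destruct a3 as (h1 & h2 & h3 & h4 & h5 & h6).
  assert (HK : gaussK f1 f2 x y fr = - (iu ^ 2) ^ 2 *
    (iv ^ 2 * (U1 ^ 2 + iw ^ 2 * (N * U2 - N' * U1) ^ 2)
     + iv ^ 2 * (V1 ^ 2 + iw ^ 2 * (N * V2 - N' * V1) ^ 2))).
  { unfold gaussK.
    replace (hcoef f1 f2 x y fr 3 2 2) with (- hcoef f1 f2 x y fr 3 1 1) by lra.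
    replace (hcoef f1 f2 x y fr 4 2 2) with (- hcoef f1 f2 x y fr 4 1 1) by lra.
    rewrite h1, h2, h4, h5. ring. }
  assert (HKN : normalK f1 f2 x y fr = (iu ^ 2) ^ 2 * (2 * iw * (U1 * V2 - U2 * V1))).
  { unfold normalK.
    replace (hcoef f1 f2 x y fr 3 2 2) with (- hcoef f1 f2 x y fr 3 1 1) by lra.
    replace (hcoef f1 f2 x y fr 4 2 2) with (- hcoef f1 f2 x y fr 4 1 1) by lra.
    rewrite h1, h3, h4, h5, h6.
    transitivity ((iu ^ 2) ^ 2 * (2 * iw * ((iv ^ 2 * N) * (U1 * V2 - U2 * V1)))).
    - ring.
    - rewrite Hv; ring. }
  (* The form multiplying [E + G] is the inverse of the Gram matrix of the normals, with entries
     [N], [N'], [N2]. The eigenvalues of that matrix are at most its trace [N + N2 = E + G], so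
     those of the inverse are at least [1 / (E + G)]. *)
  assert (low : forall a b,
    a ^ 2 + b ^ 2 <= (E + G) * (iv ^ 2 * (a ^ 2 + iw ^ 2 * (N * b - N' * a) ^ 2))).
  { intros a b. rewrite HEG.
    replace (a ^ 2 + iw ^ 2 * (N * b - N' * a) ^ 2)
      with (N * (iw ^ 2 * (N2 * a ^ 2 - 2 * N' * a * b + N * b ^ 2))).
    2:{ transitivity ((iw ^ 2 * (N * N2 - N' ^ 2)) * a ^ 2
                      + iw ^ 2 * (N * b - N' * a) ^ 2); [ring|rewrite Hw; ring]. }
    replace ((N + N2) * (iv ^ 2 *
      (N * (iw ^ 2 * (N2 * a ^ 2 - 2 * N' * a * b + N * b ^ 2)))))
      with ((iv ^ 2 * N) * ((iw ^ 2 * (N * N2 - N' ^ 2)) * (a ^ 2 + b ^ 2)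
        + iw ^ 2 * ((N2 * a - N' * b) ^ 2 + (N * b - N' * a) ^ 2))) by ring.
    rewrite Hv, Hw.
    pose proof (pow2_ge_0 iw). pose proof (pow2_ge_0 (N2 * a - N' * b)).
    pose proof (pow2_ge_0 (N * b - N' * a)). nra. }
  pose proof (low U1 U2) as l1. pose proof (low V1 V2) as l2.
  set (Q := iv ^ 2 * (U1 ^ 2 + iw ^ 2 * (N * U2 - N' * U1) ^ 2)
     + iv ^ 2 * (V1 ^ 2 + iw ^ 2 * (N * V2 - N' * V1) ^ 2)) in *.
  assert (HQ : S <= (E + G) * Q) by (unfold S, Q; lra).
  assert (HEGp : 0 < E + G).
  { rewrite EG. pose proof (pow2_ge_0 q1). pose proof (pow2_ge_0 q2). lra. }
  assert (HQp : 0 < Q) by nra.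
  assert (Hk : 0 < (iu ^ 2) ^ 2) by (apply pow_lt, pow_lt; lra).
  exists fr. split; [exact Hfr|]. split.
  - rewrite HK. nra.
  - rewrite HK, HKN, !Rabs_mult, Rabs_Ropp, (Rabs_pos_eq ((iu ^ 2) ^ 2)),
      (Rabs_pos_eq Q), (Rabs_pos_eq 2), (Rabs_pos_eq iw) by lra.
    set (J := Rabs (U1 * V2 - U2 * V1)).
    assert (HJ : 0 <= J) by apply Rabs_pos.
    replace ((iu ^ 2) ^ 2 * (2 * iw * J) / ((iu ^ 2) ^ 2 * Q))
      with ((2 * iw * J) * / Q) by (field; split; lra).
    replace ((E + G) * iw * (2 * J / S)) with ((2 * iw * J) * ((E + G) / S))
      by (field; lra).
    apply Rmult_le_compat_l; [nra|].
    apply Rmult_le_reg_r with (Q * S); [nra|].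
    replace (/ Q * (Q * S)) with S by (field; lra).
    replace ((E + G) / S * (Q * S)) with ((E + G) * Q) by (field; lra). trivial.
Qed.

(** * Constancy of the conformal structure *)

Section ConformalStructure.

Variables f1 f2 : R -> R -> R.
Hypothesis s1 : smooth2 f1.
Hypothesis s2 : smooth2 f2.

Let p1 := dpart (true :: nil) f1.
Let q1 := dpart (false :: nil) f1.
Let p2 := dpart (true :: nil) f2.
Let q2 := dpart (false :: nil) f2.
Let r1 := dpart (true :: true :: nil) f1.
Let m1 := dpart (true :: false :: nil) f1.
Let t1 := dpart (false :: false :: nil) f1.
Let r2 := dpart (true :: true :: nil) f2.
Let m2 := dpart (true :: false :: nil) f2.
Let t2 := dpart (false :: false :: nil) f2.

Lemma dpl_px f : smooth2 f -> forall x y, differentiable_pt_lim (dpart (true :: nil) f) x y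
  (dpart (true :: true :: nil) f x y) (dpart (true :: false :: nil) f x y).
Proof.
  intros s x y. rewrite <- smooth2_comm by trivial.
  exact (smooth2_dpl f (true :: nil) x y s).
Qed.

Lemma dpl_py f : smooth2 f -> forall x y, differentiable_pt_lim (dpart (false :: nil) f) x y
  (dpart (true :: false :: nil) f x y) (dpart (false :: false :: nil) f x y).
Proof. intros s x y. exact (smooth2_dpl f (false :: nil) x y s). Qed.

Let Ex x y := 2 * (p1 x y * r1 x y + p2 x y * r2 x y).
Let Ey x y := 2 * (p1 x y * m1 x y + p2 x y * m2 x y).
Let Fx x y := r1 x y * q1 x y + p1 x y * m1 x y + (r2 x y * q2 x y + p2 x y * m2 x y).
Let Fy x y := m1 x y * q1 x y + p1 x y * t1 x y + (m2 x y * q2 x y + p2 x y * t2 x y).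
Let Gx x y := 2 * (q1 x y * m1 x y + q2 x y * m2 x y).
Let Gy x y := 2 * (q1 x y * t1 x y + q2 x y * t2 x y).
Let E := gE f1 f2.
Let F := gF f1 f2.
Let G := gG f1 f2.
Let iw := iW f1 f2.
Let gx x y := Ex x y * G x y + E x y * Gx x y - 2 * F x y * Fx x y.
Let gy x y := Ey x y * G x y + E x y * Gy x y - 2 * F x y * Fy x y.

Let dpl_sq (f : R -> R -> R) x y a b :
  differentiable_pt_lim f x y a b ->
  differentiable_pt_lim (fun u v => f u v ^ 2) x y (2 * f x y * a) (2 * f x y * b).
Proof.
  intros H. apply (dpl_1d (fun a => a ^ 2)); trivial. auto_derive; trivial; ring.
Qed.

Let dE x y : differentiable_pt_lim E x y (Ex x y) (Ey x y).
Proof.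
  eapply dpl_eq.
  - apply dpl_plus; [apply dpl_plus; [apply dpl_const|]|]; apply dpl_sq; now apply dpl_px.
  - unfold Ex, p1, p2, r1, r2; ring.
  - unfold Ey, p1, p2, m1, m2; ring.
Qed.

Let dG x y : differentiable_pt_lim G x y (Gx x y) (Gy x y).
Proof.
  eapply dpl_eq.
  - apply dpl_plus; [apply dpl_plus; [apply dpl_const|]|]; apply dpl_sq; now apply dpl_py.
  - unfold Gx, q1, q2, m1, m2; ring.
  - unfold Gy, q1, q2, t1, t2; ring.
Qed.

Let dF x y : differentiable_pt_lim F x y (Fx x y) (Fy x y).
Proof.
  apply dpl_plus; apply dpl_mult; now (apply dpl_px || apply dpl_py).
Qed.

Let diw x y : differentiable_pt_lim iw x y
  (- (iw x y ^ 3 / 2) * gx x y) (- (iw x y ^ 3 / 2) * gy x y).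
Proof.
  pose proof (gdet_ge1 f1 f2 x y) as Hg.
  apply (dpl_1d (fun s => / sqrt s) (gdet f1 f2)).
  - assert (0 < sqrt (gdet f1 f2 x y)) by (apply sqrt_lt_R0; lra).
    unfold iw, iW. auto_derive; [split; lra|]. field. lra.
  - eapply dpl_eq.
    + apply dpl_minus; [apply dpl_mult; [apply dE|apply dG]|apply dpl_sq, dF].
    + unfold gx; fold E F G; ring.
    + unfold gy; fold E F G; ring.
Qed.

Let cal (l : list bool) f : smooth2 f -> forall x y, continuity_2d_pt (dpart l f) x y.
Proof. intros; now apply smooth2_cont. Qed.

Hypothesis Hm : minimal_graph f1 f2.

Lemma conformal_structure_constant x y x' y' :
  E x y * iw x y = E x' y' * iw x' y' /\ F x y * iw x y = F x' y' * iw x' y' /\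
  G x y * iw x y = G x' y' * iw x' y'.
Proof.
  set (al := fun x y => E x y * iw x y). set (be := fun x y => F x y * iw x y).
  set (ga := fun x y => G x y * iw x y).
  assert (dal : forall x y, differentiable_pt_lim al x y
    (Ex x y * iw x y + E x y * (- (iw x y ^ 3 / 2) * gx x y))
    (Ey x y * iw x y + E x y * (- (iw x y ^ 3 / 2) * gy x y)))
    by (intros; now apply dpl_mult).
  assert (dbe : forall x y, differentiable_pt_lim be x y
    (Fx x y * iw x y + F x y * (- (iw x y ^ 3 / 2) * gx x y))
    (Fy x y * iw x y + F x y * (- (iw x y ^ 3 / 2) * gy x y)))
    by (intros; now apply dpl_mult).
  assert (dga : forall x y, differentiable_pt_lim ga x y
    (Gx x y * iw x y + G x y * (- (iw x y ^ 3 / 2) * gx x y))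
    (Gy x y * iw x y + G x y * (- (iw x y ^ 3 / 2) * gy x y)))
    by (intros; now apply dpl_mult).
  set (D1 := fun x y => Fx x y * iw x y + F x y * (- (iw x y ^ 3 / 2) * gx x y)).
  set (D2 := fun x y => Fy x y * iw x y + F x y * (- (iw x y ^ 3 / 2) * gy x y)).
  assert (cal' : forall x y, continuity_2d_pt al x y) by (intros; eapply dpl_cont; apply dal).
  assert (cbe : forall x y, continuity_2d_pt be x y) by (intros; eapply dpl_cont; apply dbe).
  assert (cga : forall x y, continuity_2d_pt ga x y) by (intros; eapply dpl_cont; apply dga).
  assert (eqs : forall x y,
    Ey x y * iw x y + E x y * (- (iw x y ^ 3 / 2) * gy x y) = D1 x y /\
    Gx x y * iw x y + G x y * (- (iw x y ^ 3 / 2) * gx x y) = D2 x y).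
  { intros u v. pose proof (iW_sq f1 f2 u v) as Hw.
    destruct (minimal_surface_equation f1 f2 s1 s2 Hm u v) as [M1 M2].
    (* Inserting [iw^2 * gdet = 1] into the terms linear in [iw] makes both closedness conditions
       homogeneous of degree 3 in [iw], so that polynomial identities remain. *)
    assert (cub : forall a b, a * iw u v + b = a * (iw u v ^ 3 * gdet f1 f2 u v) + b).
    { intros a b. unfold iw.
      transitivity (a * (iW f1 f2 u v * (iW f1 f2 u v ^ 2 * gdet f1 f2 u v)) + b);
        [rewrite Hw|]; ring. }
    unfold D1, D2. rewrite !cub.
    revert M1 M2. unfold gx, gy, Ex, Ey, Fx, Fy, Gx, Gy, gdet.
    fold E F G. change (dpart (true :: true :: nil) f1 u v) with (r1 u v).
    change (dpart (true :: false :: nil) f1 u v) with (m1 u v).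
    change (dpart (false :: false :: nil) f1 u v) with (t1 u v).
    change (dpart (true :: true :: nil) f2 u v) with (r2 u v).
    change (dpart (true :: false :: nil) f2 u v) with (m2 u v).
    change (dpart (false :: false :: nil) f2 u v) with (t2 u v).
    assert (EE : E u v = 1 + p1 u v ^ 2 + p2 u v ^ 2) by reflexivity.
    assert (EF : F u v = p1 u v * q1 u v + p2 u v * q2 u v) by reflexivity.
    assert (EG : G u v = 1 + q1 u v ^ 2 + q2 u v ^ 2) by reflexivity.
    intros M1 M2. split; apply Rminus_diag_uniq.
    (* The failure of closedness is a combination of the two minimal surface expressions; its
       coefficients are the last two entries of [E X_y - F X_x] here, and of [G X_x - F X_y] in the
       second case. *)
    - transitivity (- iw u v ^ 3 * (
        (E u v * q1 u v - F u v * p1 u v)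
          * (G u v * r1 u v - 2 * F u v * m1 u v + E u v * t1 u v)
        + (E u v * q2 u v - F u v * p2 u v)
          * (G u v * r2 u v - 2 * F u v * m2 u v + E u v * t2 u v))).
      + rewrite EE, EF, EG; field.
      + rewrite M1, M2; ring.
    - transitivity (- iw u v ^ 3 * (
        (G u v * p1 u v - F u v * q1 u v)
          * (G u v * r1 u v - 2 * F u v * m1 u v + E u v * t1 u v)
        + (G u v * p2 u v - F u v * q2 u v)
          * (G u v * r2 u v - 2 * F u v * m2 u v + E u v * t2 u v))).
      + rewrite EE, EF, EG; field.
      + rewrite M1, M2; ring. }
  assert (cc : forall x y, continuity_2d_pt D1 x y /\ continuity_2d_pt D2 x y).
  { intros u v.
    assert (ciw : continuity_2d_pt iw u v) by (eapply dpl_cont; apply diw).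
    assert (cE : continuity_2d_pt E u v) by (eapply dpl_cont; apply dE).
    assert (cF : continuity_2d_pt F u v) by (eapply dpl_cont; apply dF).
    assert (cG : continuity_2d_pt G u v) by (eapply dpl_cont; apply dG).
    pose proof (cal (true :: nil) f1 s1 u v). pose proof (cal (false :: nil) f1 s1 u v).
    pose proof (cal (true :: nil) f2 s2 u v). pose proof (cal (false :: nil) f2 s2 u v).
    pose proof (cal (true :: true :: nil) f1 s1 u v).
    pose proof (cal (true :: false :: nil) f1 s1 u v).
    pose proof (cal (false :: false :: nil) f1 s1 u v).
    pose proof (cal (true :: true :: nil) f2 s2 u v).
    pose proof (cal (true :: false :: nil) f2 s2 u v).
    pose proof (cal (false :: false :: nil) f2 s2 u v).
    unfold D1, D2, gx, gy, Ex, Ey, Fx, Fy, Gx, Gy, Rdiv; simpl; split; cont2. }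
  destruct (closed_form_exact al be D1) as [A HA]; trivial.
  { intros u v. destruct (eqs u v) as [<- _]. apply (dpl_is_derive _ _ _ _ _ (dal u v)). }
  { intros u v. apply (dpl_is_derive _ _ _ _ _ (dbe u v)). }
  { intros; apply cc. }
  destruct (closed_form_exact be ga D2) as [B HB]; trivial.
  { intros u v. apply (dpl_is_derive _ _ _ _ _ (dbe u v)). }
  { intros u v. destruct (eqs u v) as [_ <-]. apply (dpl_is_derive _ _ _ _ _ (dga u v)). }
  { intros; apply cc. }
  apply (jorgens A B al be ga); trivial.
  - intros u v. unfold al. pose proof (gE_ge1 f1 f2 u v). pose proof (iW_pos f1 f2 u v).
    apply Rmult_lt_0_compat; unfold E, iw; lra.
  - intros u v. unfold al, be, ga. rewrite <- (iW_sq f1 f2 u v). unfold gdet.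
    fold E F G iw. ring.
Qed.

End ConformalStructure.

(** * Complex coordinates *)

(** Let [t0] be the last time in [[0, 1]] with [g <= k]. Then [g t0 = k] and [g > k] right after, so
    the mean value theorem finds nonzero derivatives arbitrarily close to [t0]. *)
Lemma crossing (g dg : R -> R) (k eps : R) :
  (forall t, is_derive g t (dg t)) -> g 0 < k < g 1 -> 0 < eps ->
  exists t, Rabs (g t - k) < eps /\ dg t <> 0.
Proof.
  intros Hd [H0 H1] He.
  apply NNPP; intros Hno.
  assert (flat : forall t, Rabs (g t - k) < eps -> dg t = 0).
  { intros t Ht. apply NNPP; intros N. apply Hno. now exists t. }
  assert (Hc : forall t, continuity_pt g t).
  { intros t. apply continuity_pt_filterlim, (ex_derive_continuous g). now exists (dg t). }
  assert (near : forall t e, 0 < e -> exists d, 0 < d /\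
    forall s, Rabs (s - t) < d -> Rabs (g s - g t) < e).
  { intros t e Hepos. destruct (Hc t e Hepos) as [d [Hdp Hd']].
    exists d; split; trivial. intros s Hs.
    destruct (Req_dec s t) as [->|N].
    - unfold Rminus; rewrite Rplus_opp_r, Rabs_R0; trivial.
    - apply (Hd' s). split; [split; [exact I|congruence]|exact Hs]. }
  destruct (completeness (fun t => 0 <= t <= 1 /\ g t <= k)) as [t0 [Hub Hlub]].
  - exists 1. intros t [Ht _]; lra.
  - exists 0. lra.
  - assert (t00 : 0 <= t0) by (apply Hub; lra).
    assert (t01 : t0 <= 1) by (apply Hlub; intros t [Ht _]; lra).
    assert (beyond : forall t, t0 < t <= 1 -> k < g t).
    { intros t Ht. apply Rnot_le_lt; intros N.
      assert (t <= t0) by (apply Hub; lra). lra. }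
    assert (le : g t0 <= k).
    { apply Rnot_lt_le; intros N.
      destruct (near t0 (g t0 - k)) as [d [Hdp Hd']]; [lra|].
      assert (t0 <= t0 - d / 2); [|lra].
      apply Hlub. intros t [Ht1 Ht2]. apply Rnot_lt_le; intros Nt.
      assert (t <= t0) by (apply Hub; lra).
      specialize (Hd' t). rewrite Rabs_left1 in Hd' by lra.
      specialize (Hd' ltac:(lra)). apply Rabs_def2 in Hd'. lra. }
    assert (t0lt : t0 < 1).
    { destruct (Req_dec t0 1) as [->|]; lra. }
    assert (ge : k <= g t0).
    { apply Rnot_lt_le; intros N.
      destruct (near t0 (k - g t0)) as [d [Hdp Hd']]; [lra|].
      set (t := t0 + Rmin d (1 - t0) / 2).
      assert (0 < Rmin d (1 - t0)) by (apply Rmin_pos; lra).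
      pose proof (Rmin_l d (1 - t0)). pose proof (Rmin_r d (1 - t0)).
      pose proof (beyond t ltac:(unfold t; lra)).
      specialize (Hd' t). rewrite Rabs_pos_eq in Hd' by (unfold t; lra).
      specialize (Hd' ltac:(unfold t; lra)). apply Rabs_def2 in Hd'. lra. }
    destruct (near t0 eps He) as [d [Hdp Hd']].
    set (t := t0 + Rmin d (1 - t0) / 2).
    assert (0 < Rmin d (1 - t0)) by (apply Rmin_pos; lra).
    pose proof (Rmin_l d (1 - t0)). pose proof (Rmin_r d (1 - t0)).
    assert (Ht : t0 < t <= 1) by (unfold t; lra).
    pose proof (beyond t Ht).
    destruct (MVT_gen g t0 t dg) as [c [Hc1 Hc2]]; auto.
    rewrite Rmin_left, Rmax_right in Hc1 by lra.
    rewrite (flat c) in Hc2; [lra|].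
    replace k with (g t0) by lra. apply Hd'.
    rewrite Rabs_pos_eq; unfold t in *; lra.
Qed.

(** The maximum norm of a displacement is at most its modulus, so remainders of [eps / 2] in the two
    components add up to a complex remainder of [eps]. *)
Lemma cderiv_ex_derive (U V A B : R -> R -> R) (z : C) :
  cderiv U V A B (Re z) (Im z) ->
  ex_derive (K := C_AbsRing) (V := C_NormedModule)
    (fun w : C => (U (Re w) (Im w), V (Re w) (Im w))) z.
Proof.
  intros [HU HV].
  exists ((A (Re z) (Im z), B (Re z) (Im z)) : C).
  split; [apply is_linear_scal_l|].
  intros z' Hz'.
  assert (Ez : z = z')
    by exact (is_filter_lim_locally_unique (V := AbsRing_NormedModule C_AbsRing) z z' Hz').
  subst z'.
  intros eps.
  assert (He : 0 < eps / 2) by (pose proof (cond_pos eps); lra).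
  destruct (HU (mkposreal _ He)) as [d1 H1]. destruct (HV (mkposreal _ He)) as [d2 H2].
  assert (Hm : 0 < Rmin d1 d2) by (apply Rmin_pos; apply cond_pos).
  exists (mkposreal _ Hm). intros w Hw.
  assert (Hw' : Cmod (Cminus w z) < Rmin d1 d2) by exact Hw.
  change (Cmod (Cminus (Cminus (U (Re w) (Im w), V (Re w) (Im w))
                               (U (Re z) (Im z), V (Re z) (Im z)))
                       (Cmult (Cminus w z) (A (Re z) (Im z), B (Re z) (Im z))))
          <= eps * Cmod (Cminus w z)).
  pose proof (Rmax_Cmod (Cminus w z)) as Hmx.
  pose proof (Rmin_l d1 d2). pose proof (Rmin_r d1 d2).
  destruct w as [x y], z as [x0 y0]; simpl in *.
  change (x + - x0) with (x - x0) in *. change (y + - y0) with (y - y0) in *.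
  set (m := Rmax (Rabs (x - x0)) (Rabs (y - y0))) in *.
  assert (m1 : Rabs (x - x0) <= m) by apply Rmax_l.
  assert (m2 : Rabs (y - y0) <= m) by apply Rmax_r.
  set (M := Cmod (Cminus (x, y) (x0, y0))) in *.
  specialize (H1 x y ltac:(lra) ltac:(lra)). specialize (H2 x y ltac:(lra) ltac:(lra)).
  fold m in H1, H2.
  set (e1 := U x y - U x0 y0 - (A x0 y0 * (x - x0) + - B x0 y0 * (y - y0))) in *.
  set (e2 := V x y - V x0 y0 - (B x0 y0 * (x - x0) + A x0 y0 * (y - y0))) in *.
  replace (Cminus (Cminus (U x y, V x y) (U x0 y0, V x0 y0))
                  (Cmult (Cminus (x, y) (x0, y0)) (A x0 y0, B x0 y0))) with ((e1, e2) : C).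
  2:{ unfold e1, e2, Cminus, Cplus, Copp, Cmult; simpl. f_equal; ring. }
  replace ((e1, e2) : C) with (Cplus (RtoC e1) (Cmult Ci (RtoC e2))).
  2:{ unfold Cplus, Cmult, Ci, RtoC; simpl. f_equal; ring. }
  eapply Rle_trans; [apply Cmod_triangle|].
  rewrite Cmod_mult, Cmod_Ci, !Cmod_R.
  assert (0 <= m) by (eapply Rle_trans; [apply Rabs_pos|exact m1]).
  pose proof (cond_pos eps). nra.
Qed.

(* [f1 + i f2] in the variables [(u, v)], [x = u - b v], [y = a v], for which
   [d_u = d_x] and [d_v = a d_y - b d_x]: for [e = 1] the first two functions
   are the real and imaginary parts of [2 d_z f], for [e = -1] of the conjugate of [2 d_zbar f]. *)
Lemma gradient_entire (f1 f2 : R -> R -> R) (a b e : R) :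
  smooth2 f1 -> smooth2 f2 ->
  (forall f, f = f1 \/ f = f2 -> forall x y,
     a ^ 2 * dpart (false :: false :: nil) f x y
     - 2 * a * b * dpart (true :: false :: nil) f x y
     + b ^ 2 * dpart (true :: true :: nil) f x y
     = - dpart (true :: true :: nil) f x y) ->
  let fv f x y := a * dpart (false :: nil) f x y - b * dpart (true :: nil) f x y in
  let fuv f x y := a * dpart (true :: false :: nil) f x y
                   - b * dpart (true :: true :: nil) f x y in
  entire
    (fun u v => dpart (true :: nil) f1 (u - b * v) (a * v) + e * fv f2 (u - b * v) (a * v))
    (fun u v => e * dpart (true :: nil) f2 (u - b * v) (a * v) - fv f1 (u - b * v) (a * v))
    (fun u v => dpart (true :: true :: nil) f1 (u - b * v) (a * v)
                + e * fuv f2 (u - b * v) (a * v))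
    (fun u v => e * dpart (true :: true :: nil) f2 (u - b * v) (a * v)
                - fuv f1 (u - b * v) (a * v)).
Proof.
  intros s1 s2 lap fv fuv u v.
  assert (dx : differentiable_pt_lim (fun u v => u - b * v) u v 1 (- b)).
  { eapply dpl_eq; [apply dpl_minus; [apply dpl_fst|apply dpl_scal, dpl_snd]|ring|ring]. }
  assert (dy : differentiable_pt_lim (fun u v => a * v) u v 0 a).
  { eapply dpl_eq; [apply dpl_scal, dpl_snd|ring|ring]. }
  assert (cx := dpl_cont _ _ _ _ _ dx). assert (cy := dpl_cont _ _ _ _ _ dy).
  set (x := u - b * v). set (y := a * v).
  assert (du : forall f, smooth2 f ->
    differentiable_pt_lim (fun u v => dpart (true :: nil) f (u - b * v) (a * v)) u v
      (dpart (true :: true :: nil) f x y) (fuv f x y)).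
  { intros f s. eapply dpl_eq.
    - exact (differentiable_pt_lim_comp _ (fun u v => u - b * v) (fun _ v => a * v)
        u v _ _ _ _ _ _ (dpl_px f s x y) dx dy).
    - ring.
    - unfold fuv; ring. }
  assert (dv : forall f, smooth2 f -> (f = f1 \/ f = f2) ->
    differentiable_pt_lim (fun u v => fv f (u - b * v) (a * v)) u v
      (fuv f x y) (- dpart (true :: true :: nil) f x y)).
  { intros f s Hf. eapply dpl_eq.
    - apply dpl_minus; apply dpl_scal; [|exact (du f s)].
      exact (differentiable_pt_lim_comp _ (fun u v => u - b * v) (fun _ v => a * v)
        u v _ _ _ _ _ _ (dpl_py f s x y) dx dy).
    - unfold fuv; ring.
    - rewrite <- (lap f Hf x y). unfold fuv; ring. }
  assert (cc : forall l f, smooth2 f ->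
    continuity_2d_pt (fun u v => dpart l f (u - b * v) (a * v)) u v).
  { intros l f s. apply (cont2_comp (dpart l f)); trivial. now apply smooth2_cont. }
  assert (du1 := du f1 s1). assert (du2 := du f2 s2).
  assert (dv1 := dv f1 s1 (or_introl eq_refl)). assert (dv2 := dv f2 s2 (or_intror eq_refl)).
  split; [split|split].
  - eapply dpl_eq; [apply dpl_plus; [exact du1|apply dpl_scal; exact dv2]| |].
    + reflexivity.
    + fold x y; ring.
  - eapply dpl_eq; [apply dpl_minus; [apply dpl_scal; exact du2|exact dv1]| |].
    + reflexivity.
    + fold x y; ring.
  - pose proof (cc (true :: true :: nil) f1 s1). pose proof (cc (true :: true :: nil) f2 s2).
    pose proof (cc (true :: false :: nil) f2 s2). unfold fuv; cont2.
  - pose proof (cc (true :: true :: nil) f1 s1). pose proof (cc (true :: true :: nil) f2 s2).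
    pose proof (cc (true :: false :: nil) f1 s1). unfold fuv; cont2.
Qed.

(** Near a point where the first factor is nonzero, multiplying the product by the conjugate of that
    factor shows that the second one vanishes; unique continuation extends this to the plane. *)
Lemma entire_mult_zero (U1 V1 A1 B1 U2 V2 A2 B2 : R -> R -> R) :
  entire U1 V1 A1 B1 -> entire U2 V2 A2 B2 ->
  (forall x y, U1 x y * U2 x y - V1 x y * V2 x y = 0 /\
               U1 x y * V2 x y + V1 x y * U2 x y = 0) ->
  (forall x y, U1 x y = 0 /\ V1 x y = 0) \/ (forall x y, U2 x y = 0 /\ V2 x y = 0).
Proof.
  intros H1 H2 H.
  destruct (classic (forall x y, U1 x y = 0 /\ V1 x y = 0)) as [|N]; [now left|right].
  apply not_all_ex_not in N. destruct N as [x0 N].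
  apply not_all_ex_not in N. destruct N as [y0 N].
  assert (Hc : continuity_2d_pt (fun x y => U1 x y ^ 2 + V1 x y ^ 2) x0 y0).
  { destruct (entire_cont _ _ _ _ H1 x0 y0). simpl; cont2. }
  destruct (continuity_2d_pt_neq_0 _ _ _ Hc) as [d Hd].
  { intros Z. apply N. pose proof (pow2_ge_0 (U1 x0 y0)). pose proof (pow2_ge_0 (V1 x0 y0)).
    split; nra. }
  assert (van : forall x y, Rabs (x - x0) < d -> Rabs (y - y0) < d ->
    U2 x y = 0 /\ V2 x y = 0).
  { intros x y Hx Hy. destruct (H x y) as [h1 h2]. pose proof (Hd x y Hx Hy) as Hn.
    split; apply Rmult_eq_reg_l with (U1 x y ^ 2 + V1 x y ^ 2); trivial; rewrite Rmult_0_r.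
    - transitivity (U1 x y * (U1 x y * U2 x y - V1 x y * V2 x y)
                    + V1 x y * (U1 x y * V2 x y + V1 x y * U2 x y)); [ring|].
      rewrite h1, h2; ring.
    - transitivity (U1 x y * (U1 x y * V2 x y + V1 x y * U2 x y)
                    - V1 x y * (U1 x y * U2 x y - V1 x y * V2 x y)); [ring|].
      rewrite h1, h2; ring. }
  apply (entire_vanish x0 y0 d U2 V2 A2 B2); trivial.
  - apply cond_pos.
  - intros x y Hx Hy; now apply van.
  - intros x y Hx Hy; now apply van.
Qed.

(** Differentiating a constant product gives [P' Q = - P Q']; the claim compares squared moduli. *)
Lemma entire_mult_const (U1 V1 A1 B1 U2 V2 A2 B2 : R -> R -> R) (k1 k2 : R) :
  entire U1 V1 A1 B1 -> entire U2 V2 A2 B2 ->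
  (forall x y, U1 x y * U2 x y - V1 x y * V2 x y = k1 /\
               U1 x y * V2 x y + V1 x y * U2 x y = k2) ->
  forall x y,
  (A1 x y ^ 2 + B1 x y ^ 2) * (U2 x y ^ 2 + V2 x y ^ 2) =
  (U1 x y ^ 2 + V1 x y ^ 2) * (A2 x y ^ 2 + B2 x y ^ 2).
Proof.
  intros H1 H2 H x y.
  destruct (H1 x y) as [D1 _], (H2 x y) as [D2 _].
  destruct (cderiv_mult _ _ _ _ _ _ _ _ x y D1 D2) as [HU _].
  assert (HU' := dpl_ext _ (fun _ _ => k1) x y _ _ (fun u v => proj1 (H u v)) HU).
  destruct (differentiable_pt_lim_unique _ _ _ _ _ HU') as [E1 E2].
  rewrite Derive_const in E1, E2.
  set (u1 := U1 x y) in *. set (v1 := V1 x y) in *. set (a1 := A1 x y) in *.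
  set (b1 := B1 x y) in *. set (u2 := U2 x y) in *. set (v2 := V2 x y) in *.
  set (a2 := A2 x y) in *. set (b2 := B2 x y) in *.
  transitivity ((a1 * u2 - b1 * v2) ^ 2 + (a1 * v2 + b1 * u2) ^ 2); [ring|].
  replace (a1 * u2 - b1 * v2) with (- (u1 * a2 - v1 * b2)) by lra.
  replace (a1 * v2 + b1 * u2) with (- (u1 * b2 + v1 * a2)) by lra.
  ring.
Qed.

(* [s, s', a, b] stand for [|P|^2, |Q|^2, |P'|^2, |Q'|^2]. *)
Lemma balance_bound (s s' a b k : R) :
  0 < s -> 0 < k -> s * s' = k ^ 2 -> a * s' = s * b -> 0 < a + b ->
  Rabs (a - b) / (a + b) <= 2 * Rabs (s - k) / k.
Proof.
  intros Hs Hk Hss Hab Hp.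
  assert (Hs' : 0 < s').
  { apply Rmult_lt_reg_l with s; trivial. rewrite Hss, Rmult_0_r. now apply pow_lt. }
  (* As [a : b = s : s'], the quotient to be bounded equals [|s - s'| / (s + s')], and with
     [s' = k^2 / s] it becomes [|s - k| (s + k) / (s^2 + k^2)]. *)
  assert (E : Rabs (a - b) * (s + s') = Rabs (s - s') * (a + b)).
  { rewrite <- (Rabs_pos_eq (s + s')), <- (Rabs_pos_eq (a + b)), <- !Rabs_mult by lra.
    f_equal. lra. }
  assert (E2 : Rabs (s - s') * s = Rabs (s - k) * (s + k)).
  { rewrite <- (Rabs_pos_eq s) at 2 by lra. rewrite <- (Rabs_pos_eq (s + k)) by lra.
    rewrite <- !Rabs_mult. f_equal. nra. }
  set (X := Rabs (a - b)) in *. set (Y := Rabs (s - s')) in *. set (Z := Rabs (s - k)) in *.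
  assert (HZ : 0 <= Z) by apply Rabs_pos.
  assert (E3 : X * (s ^ 2 + k ^ 2) = Z * (s + k) * (a + b)).
  { transitivity (X * (s + s') * s); [rewrite <- Hss; ring|].
    rewrite E. transitivity (Y * s * (a + b)); [ring|]. rewrite E2; ring. }
  assert (Hq : 0 < s ^ 2 + k ^ 2) by (pose proof (pow_lt s 2 Hs); pose proof (pow2_ge_0 k); lra).
  apply Rmult_le_reg_r with ((a + b) * k * (s ^ 2 + k ^ 2)).
  { repeat apply Rmult_lt_0_compat; trivial. }
  replace (X / (a + b) * ((a + b) * k * (s ^ 2 + k ^ 2)))
    with (X * (s ^ 2 + k ^ 2) * k) by (field; lra).
  rewrite E3.
  replace (2 * Z / k * ((a + b) * k * (s ^ 2 + k ^ 2)))
    with (Z * (a + b) * (2 * (s ^ 2 + k ^ 2))) by (field; lra).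
  replace (Z * (s + k) * (a + b) * k) with (Z * (a + b) * ((s + k) * k)) by ring.
  apply Rmult_le_compat_l; [nra|]. pose proof (pow2_ge_0 (s - k)). nra.
Qed.

(** * The curvature ratio *)

Lemma flat_point f1 f2 x y fr :
  smooth2 f1 -> smooth2 f2 ->
  (forall f, f = f1 \/ f = f2 ->
     dpart (true :: true :: nil) f x y = 0 /\ dpart (true :: false :: nil) f x y = 0 /\
     dpart (false :: false :: nil) f x y = 0) ->
  gaussK f1 f2 x y fr = 0.
Proof.
  intros s1 s2 H.
  destruct (H f1) as (h1 & h2 & h3); [now left|].
  destruct (H f2) as (h4 & h5 & h6); [now right|].
  unfold gaussK, hcoef. rewrite !hessX_eq, !smooth2_comm by trivial.
  rewrite h1, h2, h3, h4, h5, h6. ring.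
Qed.

Section ConformalCoordinates.

Variables f1 f2 : R -> R -> R.
Hypothesis s1 : smooth2 f1.
Hypothesis s2 : smooth2 f2.
Hypothesis Hm : minimal_graph f1 f2.

Let a := gE f1 f2 0 0 * iW f1 f2 0 0.
Let b := gF f1 f2 0 0 * iW f1 f2 0 0.
Let c := gG f1 f2 0 0 * iW f1 f2 0 0.

Lemma metric_coefs x y :
  gE f1 f2 x y * iW f1 f2 x y = a /\ gF f1 f2 x y * iW f1 f2 x y = b /\
  gG f1 f2 x y * iW f1 f2 x y = c.
Proof. now apply conformal_structure_constant. Qed.

Let apos : 0 < a.
Proof.
  pose proof (gE_ge1 f1 f2 0 0). apply Rmult_lt_0_compat; [lra|apply iW_pos].
Qed.

Let det1 : a * c - b ^ 2 = 1.
Proof. unfold a, b, c. rewrite <- (iW_sq f1 f2 0 0). unfold gdet. ring. Qed.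

(** In the coordinates [(u, v)] this is [f_vv = - f_uu]; it is [a] times the minimal surface
    equation, with [a c] replaced by [1 + b^2]. *)
Let lap f : f = f1 \/ f = f2 -> forall x y,
  a ^ 2 * dpart (false :: false :: nil) f x y
  - 2 * a * b * dpart (true :: false :: nil) f x y
  + b ^ 2 * dpart (true :: true :: nil) f x y = - dpart (true :: true :: nil) f x y.
Proof.
  intros Hf x y.
  destruct (minimal_surface_equation f1 f2 s1 s2 Hm x y) as [M1 M2].
  destruct (metric_coefs x y) as (Ha & Hb & Hc).
  assert (M : gG f1 f2 x y * dpart (true :: true :: nil) f x y
   - 2 * gF f1 f2 x y * dpart (true :: false :: nil) f x y
   + gE f1 f2 x y * dpart (false :: false :: nil) f x y = 0)
    by (destruct Hf as [-> | ->]; assumption).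
  apply (f_equal (fun z => z * iW f1 f2 x y)) in M.
  assert (M' : c * dpart (true :: true :: nil) f x y
     - 2 * b * dpart (true :: false :: nil) f x y
     + a * dpart (false :: false :: nil) f x y = 0).
  { rewrite <- Ha, <- Hb, <- Hc. lra. }
  set (r := dpart (true :: true :: nil) f x y) in *.
  transitivity (a * (c * r - 2 * b * dpart (true :: false :: nil) f x y
     + a * dpart (false :: false :: nil) f x y) - (a * c - b ^ 2) * r); [ring|].
  rewrite M', det1; ring.
Qed.

Let fv f x y := a * dpart (false :: nil) f x y - b * dpart (true :: nil) f x y.
Let fuv f x y := a * dpart (true :: false :: nil) f x y
                 - b * dpart (true :: true :: nil) f x y.
(** [re e + i im e] is [P] for [e = 1] and [Q] for [e = -1], kept as a function of [(x, y)], where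
    the curvatures live; it becomes entire after substitution of [(u, v)]. *)
Let re e x y := dpart (true :: nil) f1 x y + e * fv f2 x y.
Let im e x y := e * dpart (true :: nil) f2 x y - fv f1 x y.
Let dre e x y := dpart (true :: true :: nil) f1 x y + e * fuv f2 x y.
Let dim e x y := e * dpart (true :: true :: nil) f2 x y - fuv f1 x y.

Let P_entire e : entire (fun u v => re e (u - b * v) (a * v))
  (fun u v => im e (u - b * v) (a * v)) (fun u v => dre e (u - b * v) (a * v))
  (fun u v => dim e (u - b * v) (a * v)).
Proof. exact (gradient_entire f1 f2 a b e s1 s2 lap). Qed.

(* [(2 d_z f) * conj (2 d_zbar f)] is minus the corresponding product for the
   linear map [u + i v |-> x + i y], because the parametrization is conformal. *)
Let PQ x y : re 1 x y * re (-1) x y - im 1 x y * im (-1) x y = a ^ 2 + b ^ 2 - 1 /\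
             re 1 x y * im (-1) x y + im 1 x y * re (-1) x y = - 2 * b.
Proof.
  destruct (metric_coefs x y) as (Ha & Hb & Hc).
  pose proof (iW_pos f1 f2 x y) as Hw.
  set (w := / iW f1 f2 x y).
  assert (EE : gE f1 f2 x y = a * w) by (rewrite <- Ha; unfold w; field; lra).
  assert (EF : gF f1 f2 x y = b * w) by (rewrite <- Hb; unfold w; field; lra).
  assert (EG : gG f1 f2 x y = c * w) by (rewrite <- Hc; unfold w; field; lra).
  unfold gE in EE. unfold gF in EF. unfold gG in EG.
  unfold re, im, fv.
  set (p1 := dpart (true :: nil) f1 x y) in *. set (p2 := dpart (true :: nil) f2 x y) in *.
  set (q1 := dpart (false :: nil) f1 x y) in *. set (q2 := dpart (false :: nil) f2 x y) in *.
  split.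
  - transitivity ((p1 ^ 2 + p2 ^ 2) - (a ^ 2 * (q1 ^ 2 + q2 ^ 2)
      - 2 * a * b * (p1 * q1 + p2 * q2) + b ^ 2 * (p1 ^ 2 + p2 ^ 2))); [ring|].
    rewrite EF.
    replace (p1 ^ 2 + p2 ^ 2) with (a * w - 1) by lra.
    replace (q1 ^ 2 + q2 ^ 2) with (c * w - 1) by lra.
    transitivity (a * w - 1 + a ^ 2 + b ^ 2 - (a * c - b ^ 2) * (a * w)); [ring|].
    rewrite det1; ring.
  - transitivity (- 2 * (a * (p1 * q1 + p2 * q2) - b * (p1 ^ 2 + p2 ^ 2))); [ring|].
    rewrite EF.
    replace (p1 ^ 2 + p2 ^ 2) with (a * w - 1) by lra. ring.
Qed.

Let sq e x y := re e x y ^ 2 + im e x y ^ 2.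
Let dsq e x y := dre e x y ^ 2 + dim e x y ^ 2.

(** This identity and the next express [|P'|^2 + |Q'|^2] and [|P'|^2 - |Q'|^2] as 2 times the
    denominator and 4 times the determinant of [curvature_ratio]. *)
Let dsq_sum x y : dsq 1 x y + dsq (-1) x y =
  2 * (dpart (true :: true :: nil) f1 x y ^ 2 + fuv f1 x y ^ 2
       + dpart (true :: true :: nil) f2 x y ^ 2 + fuv f2 x y ^ 2).
Proof. unfold dsq, dre, dim. ring. Qed.

Let dsq_diff x y : dsq 1 x y - dsq (-1) x y =
  4 * (dpart (true :: true :: nil) f1 x y * fuv f2 x y
       - dpart (true :: true :: nil) f2 x y * fuv f1 x y).
Proof. unfold dsq, dre, dim. ring. Qed.

Let onto x y : exists u v, u - b * v = x /\ a * v = y.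
Proof. exists (x + b * (y / a)), (y / a). split; field; lra. Qed.

Let sq_prod x y : sq 1 x y * sq (-1) x y = (a ^ 2 + b ^ 2 - 1) ^ 2 + (2 * b) ^ 2.
Proof.
  destruct (PQ x y) as [h1 h2]. unfold sq.
  transitivity ((re 1 x y * re (-1) x y - im 1 x y * im (-1) x y) ^ 2
    + (re 1 x y * im (-1) x y + im 1 x y * re (-1) x y) ^ 2); [ring|].
  rewrite h1, h2; ring.
Qed.

Let dsq_prod x y : dsq 1 x y * sq (-1) x y = sq 1 x y * dsq (-1) x y.
Proof.
  destruct (onto x y) as (u & v & <- & <-).
  exact (entire_mult_const _ _ _ _ _ _ _ _ _ _ (P_entire 1) (P_entire (-1))
    (fun u v => PQ (u - b * v) (a * v)) u v).
Qed.

Let dsq_nonneg e x y : 0 <= dsq e x y.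
Proof. unfold dsq. pose proof (pow2_ge_0 (dre e x y)). pose proof (pow2_ge_0 (dim e x y)). lra. Qed.

Let liouville_sq e M : 0 <= M -> (forall x y, sq e x y <= M) -> forall x y, dsq e x y = 0.
Proof.
  intros HM H x y. destruct (onto x y) as (u & v & <- & <-).
  destruct (liouville _ _ _ _ (sqrt M) (P_entire e)) with (x := u) (y := v) as [h1 h2].
  - intros u' v'. specialize (H (u' - b * v') (a * v')). unfold sq in H.
    pose proof (pow2_ge_0 (re e (u' - b * v') (a * v'))).
    pose proof (pow2_ge_0 (im e (u' - b * v') (a * v'))).
    split; apply Rabs_le_of_sq; try apply sqrt_pos; rewrite pow2_sqrt; lra.
  - unfold dsq. rewrite h1, h2. ring.
Qed.

(** The constant [P Q] is 0 only for [a = 1], [b = 0], when [x] and [y] are themselves isothermal.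
    Then [P = 0] and [Q = 0] are the Cauchy-Riemann equations of anti-holomorphic and holomorphic
    [f1 + i f2]. *)
Lemma analytic_of_degenerate :
  (a ^ 2 + b ^ 2 - 1) ^ 2 + (2 * b) ^ 2 = 0 -> complex_analytic_graph f1 f2.
Proof.
  intros Z.
  assert (Hb : b = 0) by (pose proof (pow2_ge_0 (a ^ 2 + b ^ 2 - 1)); nra).
  assert (Ha : a = 1).
  { rewrite Hb in Z. assert ((a - 1) * (a + 1) = 0) by nra. nra. }
  assert (idx : forall x y, re 1 x y * re (-1) x y - im 1 x y * im (-1) x y = 0 /\
                            re 1 x y * im (-1) x y + im 1 x y * re (-1) x y = 0).
  { intros x y. destruct (PQ x y) as [h1 h2]. rewrite h1, h2, Ha, Hb. split; ring. }
  assert (CR : (forall x y, re 1 x y = 0 /\ im 1 x y = 0) \/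
               (forall x y, re (-1) x y = 0 /\ im (-1) x y = 0)).
  { destruct (entire_mult_zero _ _ _ _ _ _ _ _ (P_entire 1) (P_entire (-1))
      (fun u v => idx (u - b * v) (a * v))) as [H|H]; [left|right];
      intros x y; destruct (onto x y) as (u & v & <- & <-); apply H. }
  unfold re, im, fv in CR. rewrite Ha, Hb in CR.
  assert (d1 := fun x y => smooth2_dpl f1 nil x y s1).
  assert (d2 := fun x y => smooth2_dpl f2 nil x y s2).
  cbn [dpart] in d1, d2.
  destruct CR as [H|H].
  - right. intros z.
    assert (dn : forall x y, differentiable_pt_lim (fun _ v : R => - v) x y 0 (-1)).
    { intros x y. eapply dpl_eq; [apply dpl_opp, dpl_snd|ring|ring]. }
    apply (cderiv_ex_derive (fun x y => f1 x (- y)) (fun x y => f2 x (- y))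
      (fun x y => px f1 x (- y)) (fun x y => px f2 x (- y))).
    destruct (H (Re z) (- Im z)) as [h1 h2]. cbn [dpart] in h1, h2.
    split; cbv beta.
    + eapply dpl_eq.
      * apply (differentiable_pt_lim_comp f1 (fun u _ => u) (fun _ v => - v));
          [apply d1|apply dpl_fst|apply dn].
      * ring.
      * lra.
    + eapply dpl_eq.
      * apply (differentiable_pt_lim_comp f2 (fun u _ => u) (fun _ v => - v));
          [apply d2|apply dpl_fst|apply dn].
      * ring.
      * lra.
  - left. intros z.
    apply (cderiv_ex_derive f1 f2 (px f1) (px f2)).
    destruct (H (Re z) (Im z)) as [h1 h2]. cbn [dpart] in h1, h2.
    split.
    + eapply dpl_eq; [apply d1|reflexivity|lra].
    + eapply dpl_eq; [apply d2|reflexivity|lra].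
Qed.

Lemma small_ratio x0 y0 fr0 eps :
  (a ^ 2 + b ^ 2 - 1) ^ 2 + (2 * b) ^ 2 <> 0 -> gaussK f1 f2 x0 y0 fr0 < 0 -> 0 < eps ->
  exists r, ratio_set f1 f2 r /\ r <= eps.
Proof.
  intros Hk HK Heps.
  assert (Hkp : 0 < (a ^ 2 + b ^ 2 - 1) ^ 2 + (2 * b) ^ 2).
  { pose proof (pow2_ge_0 (a ^ 2 + b ^ 2 - 1)). pose proof (pow2_ge_0 (2 * b)). lra. }
  set (k := sqrt ((a ^ 2 + b ^ 2 - 1) ^ 2 + (2 * b) ^ 2)).
  assert (k0 : 0 < k) by now apply sqrt_lt_R0.
  assert (k2 : forall x y, sq 1 x y * sq (-1) x y = k ^ 2).
  { intros x y. rewrite sq_prod. unfold k. rewrite pow2_sqrt; lra. }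
  assert (k2p : 0 < k ^ 2) by now apply pow_lt.
  assert (sqp : forall x y, 0 < sq 1 x y /\ 0 < sq (-1) x y).
  { intros x y. specialize (k2 x y).
    assert (0 <= sq 1 x y) by (unfold sq; pose proof (pow2_ge_0 (re 1 x y));
      pose proof (pow2_ge_0 (im 1 x y)); lra).
    assert (0 <= sq (-1) x y) by (unfold sq; pose proof (pow2_ge_0 (re (-1) x y));
      pose proof (pow2_ge_0 (im (-1) x y)); lra).
    split; nra. }
  (* Where [P'] and [Q'] both vanish, all second derivatives of [f1] and [f2] vanish, contrary to
     negative curvature at this point. *)
  assert (nz : 0 < dsq 1 x0 y0 + dsq (-1) x0 y0).
  { apply Rnot_le_lt; intros N.
    assert (Z : dsq 1 x0 y0 + dsq (-1) x0 y0 = 0)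
      by (pose proof (dsq_nonneg 1 x0 y0); pose proof (dsq_nonneg (-1) x0 y0); lra).
    rewrite dsq_sum in Z.
    set (U1 := dpart (true :: true :: nil) f1 x0 y0) in *.
    set (U2 := dpart (true :: true :: nil) f2 x0 y0) in *.
    pose proof (pow2_ge_0 U1). pose proof (pow2_ge_0 U2).
    pose proof (pow2_ge_0 (fuv f1 x0 y0)). pose proof (pow2_ge_0 (fuv f2 x0 y0)).
    assert (z1 : U1 = 0) by nra. assert (z2 : U2 = 0) by nra.
    assert (z3 : fuv f1 x0 y0 = 0) by nra. assert (z4 : fuv f2 x0 y0 = 0) by nra.
    rewrite (flat_point f1 f2 x0 y0 fr0 s1 s2) in HK; [lra|].
    intros f Hf.
    assert (y1 : dpart (true :: true :: nil) f x0 y0 = 0) by (destruct Hf as [-> | ->]; assumption).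
    assert (y2 : fuv f x0 y0 = 0) by (destruct Hf as [-> | ->]; assumption).
    unfold fuv in y2. rewrite y1 in y2.
    assert (y3 : dpart (true :: false :: nil) f x0 y0 = 0).
    { apply Rmult_eq_reg_l with a; lra. }
    pose proof (lap f Hf x0 y0) as L. rewrite y1, y3 in L.
    repeat split; trivial.
    apply Rmult_eq_reg_l with (a ^ 2); [lra|]. pose proof (pow_lt a 2 apos). lra. }
  (* If one of [|P|^2], [|Q|^2] were bounded by [k], its function would have derivative 0 by
     Liouville's theorem, and [dsq_prod] would force the other derivative to be 0 too, against
     [nz]. *)
  assert (big : forall e, e = 1 \/ e = -1 -> exists x y, k < sq e x y).
  { intros e He. apply NNPP; intros N.
    assert (Z : forall x y, dsq e x y = 0).
    { apply (liouville_sq e k); [lra|]. intros x y. apply Rnot_lt_le; intros N'.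
      apply N. now exists x, y. }
    pose proof (dsq_prod x0 y0) as D. destruct (sqp x0 y0).
    destruct He as [-> | ->]; rewrite Z in D, nz; nra. }
  destruct (big 1 (or_introl eq_refl)) as (x1 & y1 & B1).
  destruct (big (-1) (or_intror eq_refl)) as (x2 & y2 & B2).
  (* The product of the squared moduli is [k^2], so [|Q|^2] above [k] means [|P|^2] below [k]. *)
  assert (B2' : sq 1 x2 y2 < k).
  { pose proof (k2 x2 y2). destruct (sqp x2 y2). nra. }
  destruct (onto x1 y1) as (u1 & v1 & <- & <-).
  destruct (onto x2 y2) as (u2 & v2 & <- & <-).
  set (uu := fun t => u2 + t * (u1 - u2)). set (vv := fun t => v2 + t * (v1 - v2)).
  set (g := fun t => sq 1 (uu t - b * vv t) (a * vv t)).
  set (U := fun u v => re 1 (u - b * v) (a * v)). set (V := fun u v => im 1 (u - b * v) (a * v)).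
  set (A := fun u v => dre 1 (u - b * v) (a * v)). set (B := fun u v => dim 1 (u - b * v) (a * v)).
  set (dg := fun t =>
    (A (uu t) (vv t) * (u1 - u2) + - B (uu t) (vv t) * (v1 - v2)) * (2 * U (uu t) (vv t))
    + (B (uu t) (vv t) * (u1 - u2) + A (uu t) (vv t) * (v1 - v2)) * (2 * V (uu t) (vv t))).
  assert (Hdg : forall t, is_derive g t (dg t)).
  { intros t. destruct (P_entire 1 (uu t) (vv t)) as [[HU HV] _].
    fold U V A B in HU, HV.
    assert (du : is_derive uu t (u1 - u2)) by (unfold uu; auto_derive; trivial; ring).
    assert (dv : is_derive vv t (v1 - v2)) by (unfold vv; auto_derive; trivial; ring).
    pose proof (dpl_curve _ uu vv t _ _ _ _
      (dpl_plus _ _ _ _ _ _ _ _ (dpl_mult _ _ _ _ _ _ _ _ HU HU)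
         (dpl_mult _ _ _ _ _ _ _ _ HV HV)) du dv) as Hg.
    eapply is_derive_eq.
    - refine (is_derive_ext _ g _ _ _ Hg). intros s.
      match goal with |- ?p = ?q => change (@eq R p q) end.
      unfold g, sq, U, V. ring.
    - unfold dg, A, B. ring. }
  (* Chosen so that the final bound [(a + c) * (2 * eta / k)] equals [eps]. *)
  set (eta := eps * k / (2 * (a + c))).
  assert (cpos : 0 < c) by nra.
  assert (Heta : 0 < eta) by (apply Rdiv_lt_0_compat; nra).
  destruct (crossing g dg k eta Hdg) as (t & Ht1 & Ht2); trivial.
  { unfold g, uu, vv.
    replace (u2 + 0 * (u1 - u2)) with u2 by ring. replace (v2 + 0 * (v1 - v2)) with v2 by ring.
    replace (u2 + 1 * (u1 - u2)) with u1 by ring. replace (v2 + 1 * (v1 - v2)) with v1 by ring.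
    now split. }
  unfold g in Ht1. set (x := uu t - b * vv t) in *. set (y := a * vv t) in *.
  assert (Hd1 : 0 < dsq 1 x y).
  { apply Rnot_le_lt; intros N. apply Ht2.
    assert (Z : dsq 1 x y = 0) by (pose proof (dsq_nonneg 1 x y); lra).
    unfold dsq in Z. pose proof (pow2_ge_0 (dre 1 x y)). pose proof (pow2_ge_0 (dim 1 x y)).
    assert (zA : dre 1 x y = 0) by nra. assert (zB : dim 1 x y = 0) by nra.
    unfold dg, A, B. fold x y. rewrite zA, zB. ring. }
  assert (Hsum : 0 < dsq 1 x y + dsq (-1) x y) by (pose proof (dsq_nonneg (-1) x y); lra).
  pose proof (balance_bound (sq 1 x y) (sq (-1) x y) (dsq 1 x y) (dsq (-1) x y) k
    (proj1 (sqp x y)) k0 (k2 x y) (dsq_prod x y) Hsum) as HB.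
  destruct (metric_coefs x y) as (Ha & Hb & Hc).
  assert (HV : forall f, iW f1 f2 x y * (gE f1 f2 x y * dpart (true :: false :: nil) f x y
     - gF f1 f2 x y * dpart (true :: true :: nil) f x y) = fuv f x y).
  { intros f. unfold fuv. rewrite <- Ha, <- Hb. ring. }
  pose proof (curvature_ratio f1 f2 x y s1 s2 Hm) as CR. cbv zeta in CR.
  rewrite !HV in CR.
  replace ((gE f1 f2 x y + gG f1 f2 x y) * iW f1 f2 x y) with (a + c) in CR by lra.
  rewrite dsq_sum in Hsum.
  destruct CR as (fr & Hfr & HKn & Hr); [lra|].
  eexists; split; [exists x, y, fr; split; [exact Hfr|split; [exact HKn|reflexivity]]|].
  eapply Rle_trans; [exact Hr|].
  rewrite dsq_diff, dsq_sum, Rabs_mult, (Rabs_pos_eq 4) in HB by lra.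
  set (J := Rabs (_ - _)) in HB at 1.
  set (S := dpart (true :: true :: nil) f1 x y ^ 2 + fuv f1 x y ^ 2
    + dpart (true :: true :: nil) f2 x y ^ 2 + fuv f2 x y ^ 2) in *.
  fold J.
  replace (2 * J / S) with (4 * J / (2 * S)) by (field; lra).
  apply Rle_trans with ((a + c) * (2 * eta / k)).
  - apply Rmult_le_compat_l; [lra|]. eapply Rle_trans; [exact HB|].
    unfold Rdiv. apply Rmult_le_compat_r; [left; now apply Rinv_0_lt_compat|lra].
  - right. unfold eta. field. lra.
Qed.

End ConformalCoordinates.

(** A point of negative curvature keeps the set of ratios nonempty: for a flat graph its infimum
    would be [p_infty]. *)
Theorem theorem1p2 (f1 f2 : R -> R -> R) :
  smooth2 f1 -> smooth2 f2 -> minimal_graph f1 f2 ->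
  ~ complex_analytic_graph f1 f2 ->
  (exists x y fr, adapted_frame f1 f2 x y fr /\ gaussK f1 f2 x y fr < 0) ->
  Glb_Rbar (ratio_set f1 f2) = Finite 0.
Proof.
  intros s1 s2 Hm Hna (x0 & y0 & fr0 & _ & HK).
  assert (Hk := fun Z => Hna (analytic_of_degenerate f1 f2 s1 s2 Hm Z)).
  apply is_glb_Rbar_unique. split.
  - intros r (x & y & fr & _ & HKn & ->). simpl.
    apply Rdiv_le_0_compat; [apply Rabs_pos|apply Rabs_pos_lt; lra].
  - intros [l| |] Hl; simpl; trivial.
    + apply Rnot_lt_le; intros Hlp.
      destruct (small_ratio f1 f2 s1 s2 Hm x0 y0 fr0 (l / 2) Hk HK) as (r & Hr & Hle); [lra|].
      specialize (Hl r Hr). simpl in Hl. lra.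
    + destruct (small_ratio f1 f2 s1 s2 Hm x0 y0 fr0 1 Hk HK) as (r & Hr & _); [lra|].
      exact (Hl r Hr).
Qed.
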